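(* Let $n \ge 1$ be an integer and let $p$ be a real number with $1 < p \le 1 + \frac{2}{n+1}$. Let $u_0, u_1 : \mathbb{R}^n_+ \to \mathbb{R}$ be initial data such that $x_n u_0 \in L^1(\mathbb{R}^n_+)$, $x_n u_1 \in L^1(\mathbb{R}^n_+)$, and $$\int_{\mathbb{R}^n_+} x_n \,(u_0(x) + u_1(x))\,dx > 0 .$$ Then there is no global classical solution $u$ to the initial-boundary value problem $$\begin{cases} u_{tt} - \Delta u + u_t = |u|^p, & t>0,\ x \in \mathbb{R}^n_+,\\ u(t,x) = 0, & t>0,\ x \in \partial \mathbb{R}^n_+,\\ u(0,x) = u_0(x),\quad u_t(0,x) = u_1(x), & x \in \mathbb{R}^n_+ .\end{cases}$$
   Context: $\mathbb{R}^n_+ = \{x = (x_1,\ldots,x_n) \in \mathbb{R}^n : x_n > 0\}$ for $n \ge 2$, and $\mathbb{R}_+^1 = \mathbb{R}_+ = (0,\infty)$ for $n=1$; when $n=1$, $x_n$ is interpreted as $x$. $\Delta$ is the Laplacian in the space variable $x$. The unknown $u = u(t,x)$ is real-valued. A global classical solution means a real-valued function $u \in C^2([0,\infty) \times \overline{\mathbb{R}^n_+})$, i.e. twice continuously differentiable up to $t = 0$ and up to the boundary $\partial\mathbb{R}^n_+$, that satisfies the equation, the boundary condition and the initial conditions pointwise, for all times $t$. *)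

(* Defs.v *)
From HB Require Import structures.
From mathcomp Require Import all_boot all_order all_algebra.
From mathcomp Require Import all_classical all_reals all_analysis.
Set Implicit Arguments.
Unset Strict Implicit.
Unset Printing Implicit Defensive.
Import Order.TTheory GRing.Theory Num.Theory.
Import numFieldNormedType.Exports.
Local Open Scope classical_set_scope.
Local Open Scope ring_scope.

Definition measure_rV_display : measure_display.
Proof. exact: default_measure_display. Qed.

(* ['rV[R]_n] carries the sigma-algebra generated by the coordinate functions
   (i.e. the Borel sigma-algebra), as the library does for [n.-tuple R]. *)
Section measurable_rV.
Context {R : realType} {n : nat}.

Let coord (i : 'I_n) (x : 'rV[R]_n) : measurableTypeR R := x ord0 i.

Let rV_set0 : g_sigma_preimage coord set0.
Proof. exact: sigma_algebra0. Qed.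

Let rV_setC A : g_sigma_preimage coord A -> g_sigma_preimage coord (~` A).
Proof. exact: sigma_algebraC. Qed.

Let rV_bigcup (F : _^nat) : (forall i, g_sigma_preimage coord (F i)) ->
  g_sigma_preimage coord (\bigcup_i (F i)).
Proof. exact: sigma_algebra_bigcup. Qed.

HB.instance Definition _ := @isMeasurable.Build measure_rV_display
  'rV[R]_n (g_sigma_preimage coord) rV_set0 rV_setC rV_bigcup.

End measurable_rV.

Section measurable_fun_rV.
Context {R : realType}.

Lemma measurable_rV_coord n (i : 'I_n) :
  measurable_fun [set: 'rV[R]_n]
    ((fun x => x ord0 i) : 'rV[R]_n -> measurableTypeR R).
Proof.
move=> _ Y mY; rewrite setTI; apply: sub_sigma_algebra => /=.
rewrite -bigcup_seq/=; exists i => /=; first by rewrite mem_index_enum.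
by exists Y => //; rewrite setTI.
Qed.

Lemma measurable_fun_rVP d (T : measurableType d) n (f : T -> 'rV[R]_n) :
  measurable_fun [set: T] f <->
  forall i, measurable_fun [set: T]
    ((fun x => f x ord0 i) : T -> measurableTypeR R).
Proof.
split=> [mf i|mf].
  exact: (measurableT_comp (measurable_rV_coord i) mf).
move=> _ A mA; rewrite setTI.
have mA1 G : sigma_algebra setT G /\
    (forall i (B : set (measurableTypeR R)), measurable B ->
      G ((fun x : 'rV[R]_n => x ord0 i) @^-1` B)) -> G A.
  move=> [sG GB]; apply: mA; split => //.
  move=> C; rewrite -bigcup_seq /= => -[i _ [B mB <-]].
  by rewrite setTI; exact: GB.
apply: (mA1 [set B | measurable (f @^-1` B)]); split; first split => /=.
- by rewrite preimage_set0.
- by move=> B mB; rewrite setTD preimage_setC; exact: measurableC.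
- by move=> F mF; rewrite preimage_bigcup; exact: bigcup_measurable.
- by move=> i B mB /=; have := mf i measurableT B mB; rewrite setTI.
Qed.

End measurable_fun_rV.

(* Lebesgue measure on R^n by induction: the point mass for n = 0, and for n.+1
   the image of (Lebesgue measure on R) \x (Lebesgue measure on R^n) under
   (t, (x_1, ..., x_n)) |-> (t, x_1, ..., x_n). *)
Section lebesgue_measure_rV.
Context {R : realType}.

Definition rV_cons n (z : measurableTypeR R * 'rV[R]_n) : 'rV[R]_n.+1 :=
  row_mx (z.1 : R)%:M z.2.

Lemma rV_cons0 n z : @rV_cons n z ord0 ord0 = z.1.
Proof.
rewrite /rV_cons (_ : ord0 = lshift n (ord0 : 'I_1)); last exact/val_inj.
by rewrite (row_mxEl (z.1%:M : 'M[R]_1)) mxE.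
Qed.

Lemma rV_consS n z i : @rV_cons n z ord0 (lift ord0 i) = z.2 ord0 i.
Proof.
rewrite /rV_cons (_ : lift ord0 i = rshift 1 i); last exact/val_inj.
by rewrite (row_mxEr (z.1%:M : 'M[R]_1)).
Qed.

Lemma measurable_rV_cons n : measurable_fun setT (@rV_cons n).
Proof.
apply/measurable_fun_rVP => i.
have [j ->|->] := unliftP ord0 i.
  under eq_fun do rewrite rV_consS.
  exact: (measurableT_comp (measurable_rV_coord j)).
by under eq_fun do rewrite rV_cons0; exact: measurable_fst.
Qed.

Section step.
Context {n : nat} (m : {sigma_finite_measure set 'rV[R]_n -> \bar R}).

Definition lebesgue_rV_step : set 'rV[R]_n.+1 -> \bar R :=
  pushforward (@lebesgue_measure R \x m)%E (@rV_cons n).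

Let step0 : lebesgue_rV_step set0 = 0%E.
Proof. by rewrite /lebesgue_rV_step /pushforward preimage_set0 measure0. Qed.

Let step_ge0 A : (0 <= lebesgue_rV_step A)%E.
Proof. by rewrite /lebesgue_rV_step /pushforward; exact: measure_ge0. Qed.

Let step_sigma_additive : semi_sigma_additive lebesgue_rV_step.
Proof.
move=> F mF tF mUF; rewrite /lebesgue_rV_step /pushforward preimage_bigcup.
apply: measure_semi_sigma_additive.
- by move=> k; rewrite -[X in measurable X]setTI; exact: measurable_rV_cons.
- apply/trivIsetP => /= i j _ _ ij; rewrite -preimage_setI.
  by move/trivIsetP : tF => /(_ _ _ _ _ ij) ->//; rewrite preimage_set0.
- rewrite -preimage_bigcup -[X in measurable X]setTI.
  exact: measurable_rV_cons.
Qed.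

HB.instance Definition _ := isMeasure.Build _ _ _ lebesgue_rV_step
  step0 step_ge0 step_sigma_additive.

Let sigma_finite_step : sigma_finite setT lebesgue_rV_step.
Proof.
have /sigma_finiteP[F [TF ndF Foo]] := sigma_finiteT (@lebesgue_measure R).
have /sigma_finiteP[G [TG ndG Goo]] := sigma_finiteT m.
pose g (x : 'rV[R]_n.+1) : measurableTypeR R * 'rV[R]_n :=
  (x ord0 ord0, \row_i x ord0 (lift ord0 i)).
have mg : measurable_fun setT g.
  apply: measurable_fun_pair; first exact: measurable_rV_coord.
  apply/measurable_fun_rVP => i.
  by under eq_fun do rewrite mxE; exact: measurable_rV_coord.
have gK z : g (rV_cons z) = z.
  case: z => t x; rewrite /g rV_cons0; congr pair.
  by apply/rowP => i; rewrite mxE rV_consS.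
have mFG k : measurable (F k `*` G k).
  by apply: measurableX; [have [] := Foo k | have [] := Goo k].
exists (fun k => g @^-1` (F k `*` G k)).
  rewrite -preimage_bigcup -[LHS](preimage_setT g); congr (g @^-1` _).
  rewrite -setXTT TF TG predeqE => -[x y]; split.
    move=> [/= [k _ Fkx] [l _ Gly]]; exists (maxn k l) => //; split.
    - by move: x Fkx; exact/subsetPset/ndF/leq_maxl.
    - by move: y Gly; exact/subsetPset/ndG/leq_maxr.
  by move=> [k _ []/= ? ?]; split; exists k.
move=> k; split; first by rewrite -[X in measurable X]setTI; exact: mg.
rewrite /lebesgue_rV_step /pushforward -comp_preimage.
rewrite (_ : g \o _ = id) ?preimage_id; last by apply/funext => z /=.
have [? ?] := Foo k; have [? ?] := Goo k.
by rewrite product_measure1E// lte_mul_pinfty// ge0_fin_numE.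
Qed.

HB.instance Definition _ :=
  Measure_isSigmaFinite.Build _ _ _ lebesgue_rV_step sigma_finite_step.

End step.

Fixpoint lebesgue_rV n : {sigma_finite_measure set 'rV[R]_n -> \bar R} :=
  match n with
  | 0 => [the {sigma_finite_measure set _ -> \bar R} of \d_(0 : 'rV[R]_0)]
  | k.+1 => [the {sigma_finite_measure set _ -> \bar R} of
              lebesgue_rV_step (lebesgue_rV k)]
  end.

(* Sanity check: [lebesgue_rV] is the product measure. *)
Lemma lebesgue_rV_box n (A : 'I_n -> set (measurableTypeR R)) :
  (forall i, measurable (A i)) ->
  lebesgue_rV n [set x | forall i, A i (x ord0 i)] =
  (\prod_(i < n) lebesgue_measure (A i))%E.
Proof.
elim: n => [|n IH] in A * => mA.
  rewrite big_ord0 /= diracE mem_set//= => -[]//.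
rewrite big_ord_recl -(IH (fun i => A (lift ord0 i)))//.
rewrite /= /lebesgue_rV_step /pushforward.
rewrite -product_measure1E//; last first.
  rewrite [X in measurable X](_ : _ =
    \bigcap_(i in [set: 'I_n])
      ((fun x : 'rV[R]_n => x ord0 i) @^-1` A (lift ord0 i))).
    apply: fin_bigcap_measurable => // i _.
    by rewrite -[X in measurable X]setTI; exact: measurable_rV_coord.
  by apply/seteqP; split=> x /= h i; [move=> _; exact: h | exact: h].
congr (product_measure1 _ _ _)%E; apply/seteqP; split=> z /=.
  move=> h; split; first by have := h ord0; rewrite rV_cons0.
  by move=> i; have := h (lift ord0 i); rewrite rV_consS.
move=> [h0 hS] i; have [j ->|->] := unliftP ord0 i.
  by rewrite rV_consS.
by rewrite rV_cons0.
Qed.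

End lebesgue_measure_rV.

(* The dimension, at least 1, is written n.+1, so that the last coordinate
   x_n is [x ord0 ord_max]. *)
Section damped_wave_half_space.
Context {R : realType} {n : nat}.
Notation space := 'rV[R]_n.+1.
Notation spacetime := (R * space)%type.
Implicit Types (x : space) (z : spacetime) (u : spacetime -> R).

Definition half_space : set space := [set x | 0 < x ord0 ord_max].

Definition half_space_boundary : set space :=
  closure half_space `\` interior half_space.

(* the coordinate directions of spacetime: [None] is time *)
Definition coord_dir (k : option 'I_n.+1) : spacetime :=
  if k is Some i then (0, delta_mx ord0 i) else (1, 0).

Definition partial k u : spacetime -> R := 'D_(coord_dir k) u.

Definition partial_t u : spacetime -> R := partial None u.

Definition laplacian u : spacetime -> R :=
  fun z => \sum_(i < n.+1) partial (Some i) (partial (Some i) u) z.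

Definition spacetime_interior : set spacetime :=
  [set t | 0 < t] `*` half_space.

Definition spacetime_closed : set spacetime :=
  [set t | 0 <= t] `*` closure half_space.

Definition extends_continuously (f : spacetime -> R) : Prop :=
  exists2 g : spacetime -> R, {within spacetime_closed, continuous g} &
    forall z, spacetime_interior z -> f z = g z.

(* C^2 on [0, oo) x (closed half-space): u is continuous there, and all partial
   derivatives of order at most 2 exist in the interior and extend
   continuously to the closed set. Values of u outside the closed set are
   irrelevant. *)
Definition C2_closed u : Prop :=
  [/\ {within spacetime_closed, continuous u},
      forall k,
        (forall z, spacetime_interior z -> derivable u z (coord_dir k)) /\
        extends_continuously (partial k u)
    & forall k l,
        (forall z, spacetime_interior z ->
          derivable (partial k u) z (coord_dir l)) /\
        extends_continuously (partial l (partial k u))].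

(* At t = 0 the time derivative is the one-sided one. *)
Definition global_classical_solution (p : R) (u0 u1 : space -> R) u : Prop :=
  [/\ C2_closed u,
      forall t x, 0 < t -> half_space x ->
        partial_t (partial_t u) (t, x) - laplacian u (t, x)
          + partial_t u (t, x) = `|u (t, x)| `^ p,
      forall t x, 0 < t -> half_space_boundary x -> u (t, x) = 0,
      forall x, half_space x -> u (0, x) = u0 x
    & forall x, half_space x ->
        h^-1 * (u (h, x) - u (0, x)) @[h --> 0^'+] --> u1 x].

End damped_wave_half_space.
Arguments half_space {R n}.
Arguments half_space_boundary {R n}.

(* Main.v *)
Require Import Defs.
From mathcomp Require Import all_boot all_order all_algebra.
From mathcomp Require Import all_classical all_reals all_analysis measurable_realfun.
From mathcomp Require Import ring lra.
Set Implicit Arguments.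
Unset Strict Implicit.
Unset Printing Implicit Defensive.
Import Order.TTheory GRing.Theory Num.Theory.
Import numFieldNormedType.Exports.
Local Open Scope classical_set_scope.
Local Open Scope ring_scope.

(* Test function method.  Write N = n.+1 and test the equation against
   x_N phi_T(t, x), where phi_T is the product of the cut-offs
   (1 - (t/T^2)^2)^(m+2) and (1 - (x_i/T)^2)^(m+2) on the parabolic cylinder
   0 < t < T^2, |x_i| < T, x_N > 0.  The weight x_N vanishes on the boundary and
   is harmonic, and phi_T is even in t and in x_N, so every boundary term
   vanishes except the one at t = 0, which converges to the integral J > 0 of
   x_N (u0 + u1); the adjoint operator applied to x_N phi_T is at most
   C T^-2 x_N rho^m, with rho the product of the factors.  Since x_N dx dt gives
   the cylinder mass of order T^(N+3), Young's inequality at the scale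
   |u| ~ M T^-(N+1) leaves an error C M uniform in T exactly when
   p <= 1 + 2/(N+1).  With M large this shows that x_N |u|^p is integrable on
   the whole spacetime; with M small, dominated convergence then gives
   J <= C M for every M > 0. *)

(** * Borel sets and continuous functions on spacetime *)

Lemma measurable_cylinder (R : realType) n (P : set R) (Q : 'I_n -> set R) :
  measurable (P : set (measurableTypeR R)) ->
  (forall i, measurable (Q i : set (measurableTypeR R))) ->
  measurable [set y : measurableTypeR R * 'rV[R]_n |
    P y.1 /\ forall i, Q i (y.2 ord0 i)].
Proof.
move=> mP mQ.
apply: (@measurableX _ _ _ _ P [set x : 'rV[R]_n | forall i, Q i (x ord0 i)]) => //.
rewrite [X in measurable X](_ : _ =
    \bigcap_(i in [set: 'I_n]) ((fun x : 'rV[R]_n => x ord0 i) @^-1` Q i)).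
  apply: fin_bigcap_measurable => // i _.
  by rewrite -[X in measurable X]setTI; exact: measurable_rV_coord.
by apply/seteqP; split=> x /= h i; [move=> _; exact: h | exact: h].
Qed.

(** The rational boxes of radius [1/(k+1)] contained in [A] are countably many and cover it. This
    reconciles the topology with the sigma-algebra generated by the coordinates. *)
Lemma open_measurable_prod_rV (R : realType) n (A : set (R * 'rV[R]_n)) :
  open A -> measurable (A : set (measurableTypeR R * 'rV[R]_n)).
Proof.
move=> oA.
pose box (q : rat * 'rV[rat]_n * nat) : set (measurableTypeR R * 'rV[R]_n) :=
  [set y : R * 'rV[R]_n | ball (ratr q.1.1 : R) (q.2.+1%:R^-1) y.1 /\
    forall i, ball (ratr (q.1.2 ord0 i) : R) (q.2.+1%:R^-1) (y.2 ord0 i)].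
have mbox q : measurable (box q).
  apply: (@measurable_cylinder _ _ (ball _ _) (fun i => ball _ _)) => [|i];
    exact: measurable_ball.
suff -> : A = \bigcup_q (if `[< box q `<=` A >] then box q else set0).
  apply: countable_bigcupT_measurable; first exact: countableP.
  by move=> q; case: ifPn.
apply/seteqP; split => [z Az|z [q _]]; last first.
  by case: ifPn => // /asboolP + zq; exact.
have : nbhs z A by exact: open_nbhs_nbhs.
rewrite -nbhs_ballE => -[e /= e0 zeA].
(* Half of [e], because [z] and any other point of the box are each within one radius of its
   centre. *)
have e20 : 0 < e / 2 by rewrite divr_gt0.
pose k := Num.truncn (e / 2)^-1.
have k0 : 0 < k.+1%:R^-1 :> R by rewrite invr_gt0.
have ke : k.+1%:R^-1 < e / 2.
  rewrite -[ltRHS]invrK ltf_pV2 ?posrE ?invr_gt0//.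
  exact: truncnS_gt.
have rat_near (x : R) : exists q : rat, ball (ratr q : R) k.+1%:R^-1 x.
  have /rat_in_itvoo[q] : x < x + k.+1%:R^-1 by rewrite ltrDl.
  rewrite in_itv/= => /andP[xq qx]; exists q.
  by rewrite /ball/= gtr0_norm ?subr_gt0// ltrBlDl.
have [q1 q1P] := rat_near z.1.
have [q2 q2P] := choice (fun i => rat_near (z.2 ord0 i)).
exists ((q1, \row_i q2 i), k) => //.
have zq : box ((q1, \row_i q2 i), k) z.
  by split => //= i; rewrite mxE; exact: q2P.
suff bA : box ((q1, \row_i q2 i), k) `<=` A by rewrite asboolT.
move=> y [y1 y2]; apply: zeA.
have dbl : k.+1%:R^-1 + k.+1%:R^-1 <= e :> R.
  by rewrite [leRHS]splitr lerD// ltW.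
split.
  apply: le_ball dbl _ _; apply: ball_triangle; last exact: y1.
  exact: ball_sym.
split => // i j; rewrite (ord1 i); apply: (le_ball dbl).
have := y2 j; rewrite /= mxE => y2j.
by apply: ball_triangle y2j; exact: ball_sym.
Qed.

Lemma continuous_measurable_prod_rV (R : realType) n
    (f : R * 'rV[R]_n -> R) :
  continuous f ->
  measurable_fun [set: measurableTypeR R * 'rV[R]_n] (f : _ -> measurableTypeR R).
Proof.
move=> /continuousP cf; apply: (measurability _ (RGenOpens.measurableE R)).
move=> /= _ [_ [a [b ->]] <-]; rewrite setTI.
by apply: open_measurable_prod_rV; apply: cf; exact: interval_open.
Qed.

(** * Fubini's theorem, one coordinate at a time *)

Section lebesgue_rV_fubini.
Context {R : realType}.
Local Notation mu := (@lebesgue_measure R).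
Local Open Scope ereal_scope.

Definition row_set n (i : 'I_n) (s : R) (x : 'rV[R]_n) : 'rV[R]_n :=
  \row_j (if j == i then s else x ord0 j).

Lemma integrable_rV_cons n (f : 'rV[R]_n.+1 -> \bar R) :
  (lebesgue_rV n.+1).-integrable setT f ->
  (mu \x lebesgue_rV n).-integrable setT (f \o @rV_cons R n).
Proof.
move=> /integrableP[mf intf]; apply/integrableP; split.
  exact: (measurableT_comp mf (@measurable_rV_cons R n)).
have mn : measurable_fun setT (abse \o f) by exact: measurableT_comp.
have := @ge0_integral_pushforward _ _ _ _ _ _ (@measurable_rV_cons R n)
  (mu \x lebesgue_rV n) setT (abse \o f) measurableT mn (fun y _ => abse_ge0 _).
by rewrite preimage_setT => <-.
Qed.

Lemma integral_rV_cons n (f : 'rV[R]_n.+1 -> \bar R) :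
  (lebesgue_rV n.+1).-integrable setT f ->
  \int[lebesgue_rV n.+1]_x f x = \int[mu \x lebesgue_rV n]_z f (rV_cons z).
Proof.
move=> intf; have := integrable_rV_cons intf.
rewrite -[setT in X in X -> _](preimage_setT (@rV_cons R n)) => intf'.
have mf : measurable_fun setT f by case/integrableP: intf.
exact: (integral_pushforward (@measurable_rV_cons R n) mf intf' measurableT).
Qed.

(** By induction on the dimension, coordinates are split off until [i] is the first one. Slices are
    integrable only almost everywhere, which is enough under the outer integral. *)
Lemma integral_row_set0 n (i : 'I_n) (f : 'rV[R]_n -> \bar R) :
  (lebesgue_rV n).-integrable setT f ->
  (forall x, \int[mu]_s f (row_set i s x) = 0) ->
  \int[lebesgue_rV n]_x f x = 0.
Proof.
elim: n => [|n IH] in i f *; first by case: i.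
move=> intf f0; rewrite integral_rV_cons//.
have intf' := integrable_rV_cons intf.
have [j ij|ij] := unliftP ord0 i; last first.
  (* Here [i] is the first coordinate, and its integral is taken as the inner one. *)
  rewrite -integral21_prod_meas1//; apply: integral0_eq => x _.
  rewrite /fubini_G -[RHS](f0 (rV_cons (0%R, x))); apply: eq_integral => s _ /=.
  congr f; apply/rowP => k; rewrite [RHS]mxE {}ij; have [l ->|->] := unliftP ord0 k.
    by rewrite !rV_consS.
  by rewrite eqxx rV_cons0.
rewrite -integral12_prod_meas1//.
rewrite -(@integral0 _ _ _ mu setT); apply: ae_eq_integral => //.
  exact: (measurable_fubini_F intf').
apply: filterS (ae_integrable1 intf') => t intt _.
rewrite /fubini_F (IH j)// => x; rewrite -[RHS](f0 (rV_cons (t, x))).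
apply: eq_integral => s _ /=.
congr f; apply/rowP => k; rewrite [RHS]mxE {}ij; have [l ->|->] := unliftP ord0 k.
  by rewrite !rV_consS mxE (inj_eq lift_inj).
by rewrite (negbTE (neq_lift _ _)) !rV_cons0.
Qed.
End lebesgue_rV_fubini.

(** * Integration by parts on an interval *)

Lemma integral_oo_derive (R : realType) (a b : R) (F f : R -> R) :
  a < b -> continuous F -> continuous f ->
  (forall s, s \in `]a, b[ -> is_derive s 1 F (f s)) ->
  (\int[lebesgue_measure]_(x in `]a, b[) (f x)%:E = (F b - F a)%:E)%E.
Proof.
move=> ab cF cf dF.
have mf (A : set R) : measurable_fun A (EFin \o f).
  apply/measurable_EFinP/measurable_funTS.
  exact: continuous_measurable_fun.
rewrite integral_itv_bndo_bndc ?integral_itv_obnd_cbnd//.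
rewrite (continuous_FTC2 ab (F := F))//.
- exact: continuous_subspaceT.
- split.
  + by move=> x /dF [].
  + by apply: cvg_at_right_filter; exact: cF.
  + by apply: cvg_at_left_filter; exact: cF.
- by move=> x /dF dFx; rewrite derive1E derive_val.
Qed.

Section green.
Variables (R : realType) (a b : R) (q : {poly R}) (f f1 f2 : R -> R).
Hypotheses (ab : a < b) (cf : continuous f) (cf1 : continuous f1)
  (cf2 : continuous f2) (df : forall s, s \in `]a, b[ -> is_derive s 1 f (f1 s))
  (df1 : forall s, s \in `]a, b[ -> is_derive s 1 f1 (f2 s)).

Let cq (r : {poly R}) : continuous (horner r).
Proof. exact: continuous_horner. Qed.

(** The integrand is the derivative of [q f1 - q' f]. *)
Lemma green_formula1 :
  (\int[lebesgue_measure]_(s in `]a, b[)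
     (q.[s] * f2 s - q^`()^`().[s] * f s)%:E =
   ((q.[b] * f1 b - q^`().[b] * f b) - (q.[a] * f1 a - q^`().[a] * f a))%:E)%E.
Proof.
apply: (@integral_oo_derive _ _ _ (fun s => q.[s] * f1 s - q^`().[s] * f s))
  => //.
- by move=> s; apply: cvgB; apply: cvgM; do ?[exact: cq|exact: cf1|exact: cf].
- by move=> s; apply: cvgB; apply: cvgM; do ?[exact: cq|exact: cf2|exact: cf].
- move=> s sab; have := df sab; have := df1 sab => ? ?.
  apply: is_derive_eq.
  rewrite /GRing.scale/=; ring.
Qed.

(** The formal adjoint of [d^2 + d] is [d^2 - d]; a primitive of the integrand is
    [q (f1 + f) - q' f]. *)
Lemma green_formula1_damped :
  (\int[lebesgue_measure]_(s in `]a, b[)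
     (q.[s] * (f2 s + f1 s) - (q^`()^`().[s] - q^`().[s]) * f s)%:E =
   ((q.[b] * (f1 b + f b) - q^`().[b] * f b)
    - (q.[a] * (f1 a + f a) - q^`().[a] * f a))%:E)%E.
Proof.
apply: (@integral_oo_derive _ _ _
  (fun s => q.[s] * (f1 s + f s) - q^`().[s] * f s)) => //.
- move=> s; apply: cvgB; apply: cvgM; do ?[exact: cq|exact: cf].
  by apply: cvgD; [exact: cf1|exact: cf].
- move=> s; apply: cvgB; apply: cvgM; do ?[exact: cq|exact: cf].
    by apply: cvgD; [exact: cf2|exact: cf1].
  by apply: cvgB; exact: cq.
- move=> s sab; have := df sab; have := df1 sab => ? ?.
  apply: is_derive_eq.
  rewrite /GRing.scale/=; ring.
Qed.

End green.

(** By the mean value theorem the quotient is a value of [f1] between 0 and [h]. *)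
Lemma right_derive_lim (R : realType) (f f1 : R -> R) (b : R) :
  0 < b -> continuous f -> continuous f1 ->
  (forall s, s \in `]0, b[ -> is_derive s 1 f (f1 s)) ->
  h^-1 * (f h - f 0) @[h --> 0^'+] --> f1 0.
Proof.
move=> b0 cf cf1 df.
apply/cvgrPdist_le => /= e e0.
have /cvgrPdist_le/(_ e e0) [d /= d0 dP] := cf1 0.
near=> h.
have h0 : 0 < h by [].
have [|c] := @MVT _ f f1 0 h h0 _ (continuous_subspaceT cf).
  move=> s; rewrite in_itv/= => /andP[s0 sh]; apply: df; rewrite in_itv/= s0/=.
  by apply: lt_trans sh _; near: h; exact: nbhs_right_lt.
rewrite in_itv/= => /andP[c0 ch]; rewrite subr0 => ->.
rewrite mulrCA mulVf ?mulr1 ?gt_eqF//; apply: dP => /=.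
rewrite sub0r normrN gtr0_norm//; apply: lt_trans ch _.
by near: h; exact: nbhs_right_lt.
Unshelve. all: by end_near. Qed.

(** * Restriction to lines *)

Lemma row_setE (R : realType) n (i : 'I_n) (s : R) x :
  row_set i s x = x + (s - x ord0 i) *: delta_mx ord0 i.
Proof.
apply/rowP => j; rewrite !mxE eqxx/=; case: eqP => [->|_].
  by rewrite mulr1 addrCA subrr addr0.
by rewrite mulr0 addr0.
Qed.

Lemma row_set_id (R : realType) n (i : 'I_n) (x : 'rV[R]_n) :
  row_set i (x ord0 i) x = x.
Proof. by rewrite row_setE subrr scale0r addr0. Qed.

(** An increment [h] of the parameter moves the point by [h *: v], so the two difference quotients
    are the same function of [h]. *)
Lemma is_derive_line (R : realType) (V : normedModType R) (f : V -> R)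
    (L : R -> V) (v : V) (s d : R) :
  (forall h, L (h + s) = h *: v + L s) ->
  is_derive (L s) v f d -> is_derive s 1 (f \o L) d.
Proof.
move=> Ls [df fd].
have E : (fun h => h^-1 *: ((f \o shift (L s)) (h *: v) - f (L s))) =
  (fun h => h^-1 *: (((f \o L) \o shift s) (h *: 1) - (f \o L) s)).
  by apply/funext => h /=; rewrite /shift/= [h *: 1]mulr1 Ls.
by split; [rewrite /derivable -E | rewrite /derive -E].
Qed.

Lemma continuous_pair (T U V : topologicalType) (f : T -> U) (g : T -> V) :
  continuous f -> continuous g -> continuous (fun z => (f z, g z)).
Proof.
move=> cf cg z; apply: (@cvg_pair _ _ _ (nbhs z) (nbhs (f z)) (nbhs (g z))).
  exact: cf.
exact: cg.
Qed.

Lemma continuous_max0 (R : realType) : continuous (fun s : R => Num.max s 0).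
Proof.
under eq_fun do rewrite maxr_absE subr0 addr0.
move=> s; apply: cvgM; last exact: cvg_cst.
apply: cvgD; first exact: cvg_id.
exact: (@norm_continuous _ R^o s).
Qed.

(** * Geometry of the half-space and continuous extension of a solution *)

Section half_space_geometry.
Context {R : realType} {n : nat}.
Notation space := 'rV[R]_n.+1.
Notation spacetime := (R * space)%type.

Lemma continuous_row_set (i : 'I_n.+1) (x : space) :
  continuous (fun s : R => row_set i s x).
Proof.
under eq_fun do rewrite row_setE.
move=> s; apply: cvgD; first exact: cvg_cst.
by apply: cvgZr_tmp; apply: cvgB; [exact: cvg_id|exact: cvg_cst].
Qed.

Lemma open_half_space : open (@half_space R n).
Proof.
apply: (@open_comp _ _ (fun x : space => x ord0 ord_max) [set r | 0 < r]); last exact: open_gt.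
by move=> x _; exact: coord_continuous.
Qed.

Lemma open_spacetime_interior : open (@spacetime_interior R n).
Proof.
apply: (@openI _ ((fst : spacetime -> R) @^-1` [set r | 0 < r])
  ((snd : spacetime -> space) @^-1` half_space)); apply: open_comp.
- by move=> z _; exact: cvg_fst.
- exact: open_gt.
- by move=> z _; exact: cvg_snd.
- exact: open_half_space.
Qed.

(** Raising the last coordinate by any small amount moves the point into the half-space. *)
Lemma closure_half_space (x : space) : 0 <= x ord0 ord_max -> closure half_space x.
Proof.
move=> x0 B Bx.
have : \forall s \near (x ord0 ord_max)^'+, B (row_set ord_max s x).
  apply: (cvg_at_right_filter (@continuous_row_set ord_max x _)).
  by rewrite row_set_id.
move=> Bs.
have [s [Bsx xs]] : exists s, B (row_set ord_max s x) /\ x ord0 ord_max < s.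
  apply: (@filter_ex _ (x ord0 ord_max)^'+).
  by near=> s; split; near: s; [exact: Bs|exact: nbhs_right_gt].
exists (row_set ord_max s x); split => //.
by rewrite /half_space/= mxE eqxx (le_lt_trans x0).
Unshelve. all: by end_near. Qed.

Lemma half_space_boundaryP (x : space) : x ord0 ord_max = 0 -> half_space_boundary x.
Proof.
move=> x0; split; first by apply: closure_half_space; rewrite x0.
by move=> /interior_subset; rewrite /half_space/= x0 ltxx.
Qed.

(** A continuous retraction onto [spacetime_closed], truncating negative [t] and [x_N] to 0.
    Composition with it turns continuity within the closed set into continuity everywhere, so that
    no later argument needs subspace topologies. *)
Definition fold_spacetime (z : spacetime) : spacetime :=
  (Num.max z.1 0, row_set ord_max (Num.max (z.2 ord0 ord_max) 0) z.2).

Lemma continuous_fold_spacetime : continuous fold_spacetime.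
Proof.
have c2 : continuous (fun z : spacetime => z.2 ord0 ord_max).
  move=> {}z; apply: (@continuous_comp _ _ _ snd (fun x : space => x ord0 ord_max)).
    exact: cvg_snd.
  exact: coord_continuous.
apply: continuous_pair => z.
  apply: (@continuous_comp _ _ _ fst (fun s : R => Num.max s 0)).
    exact: cvg_fst.
  exact: continuous_max0.
under eq_fun do rewrite row_setE.
apply: cvgD; first exact: cvg_snd.
apply: cvgZr_tmp; apply: cvgB; last exact: c2.
apply: (@continuous_comp _ _ _ (fun z : spacetime => z.2 ord0 ord_max)
  (fun s : R => Num.max s 0)); first exact: c2.
exact: continuous_max0.
Qed.

Lemma fold_spacetime_closed (z : spacetime) : spacetime_closed (fold_spacetime z).
Proof.
split; first by rewrite /= le_max lexx orbT.
by apply: closure_half_space; rewrite /= mxE eqxx le_max lexx orbT.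
Qed.

Lemma fold_spacetime_id (z : spacetime) : 0 <= z.1 -> 0 <= z.2 ord0 ord_max ->
  fold_spacetime z = z.
Proof.
case: z => t x /= t0 x0; rewrite /fold_spacetime/=.
by rewrite !max_l// row_set_id.
Qed.

Lemma continuous_fold (g : spacetime -> R) :
  {within spacetime_closed, continuous g} -> continuous (g \o fold_spacetime).
Proof.
move=> /subspace_continuousP/(_ _ (fold_spacetime_closed _)) cg z B.
move=> /cg Bz0; have Bz := continuous_fold_spacetime Bz0.
suff : nbhs z ((g \o fold_spacetime) @^-1` B) by [].
by apply: (@filterS _ (nbhs z) _ _ _ _ Bz) => y /= /(_ (fold_spacetime_closed _)).
Qed.

End half_space_geometry.

(* [U] extends [u], and [G k], [H k] extend its first and second derivatives in
   the direction [k], continuously to all of spacetime (by folding). *)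
Record smooth_solution (R : realType) (n : nat) (p : R)
    (u0 u1 : 'rV[R]_n.+1 -> R) (U : R * 'rV[R]_n.+1 -> R)
    (G H : option 'I_n.+1 -> R * 'rV[R]_n.+1 -> R) : Prop := SmoothSolution {
  smooth_cont : continuous U ;
  smooth_cont1 : forall k, continuous (G k) ;
  smooth_cont2 : forall k, continuous (H k) ;
  smooth_deriv : forall k z, spacetime_interior z ->
    is_derive z (coord_dir k) U (G k z) ;
  smooth_deriv2 : forall k z, spacetime_interior z ->
    is_derive z (coord_dir k) (G k) (H k z) ;
  smooth_pde : forall z, spacetime_interior z ->
    H None z - \sum_i H (Some i) z + G None z = `|U z| `^ p ;
  smooth_bnd : forall t (x : 'rV[R]_n.+1), 0 < t -> x ord0 ord_max = 0 -> U (t, x) = 0 ;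
  smooth_init : forall x, half_space x -> U (0, x) = u0 x ;
  smooth_init1 : forall x, half_space x -> G None (0, x) = u1 x }.

(** The function [u] and the continuous extensions of its pure derivatives are composed with the
    retraction, which changes nothing in the interior. *)
Lemma smooth_solution_exists (R : realType) (n : nat) (p : R)
    (u0 u1 : 'rV[R]_n.+1 -> R) u :
  global_classical_solution p u0 u1 u ->
  exists U G H, smooth_solution p u0 u1 U G H.
Proof.
move=> [[cu /= du ddu] pde bnd init init1].
have foldE (z : R * 'rV[R]_n.+1) : spacetime_interior z -> fold_spacetime z = z.
  by move=> [/ltW ? /ltW ?]; rewrite fold_spacetime_id.
have /choice[g gP] : forall k, exists g : R * 'rV[R]_n.+1 -> R, continuous g /\
    forall z, spacetime_interior z -> partial k u z = g z.
  move=> k; have [_ [g cg gE]] := du k; exists (g \o fold_spacetime).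
  by split => [|z zI]; [exact: continuous_fold|rewrite /= foldE// gE].
have /choice[h hP] : forall k, exists h : R * 'rV[R]_n.+1 -> R, continuous h /\
    forall z, spacetime_interior z -> partial k (partial k u) z = h z.
  move=> k; have [_ [h ch hE]] := ddu k k; exists (h \o fold_spacetime).
  by split => [|z zI]; [exact: continuous_fold|rewrite /= foldE// hE].
pose U := u \o (@fold_spacetime R n).
have UE z : spacetime_interior z -> U z = u z by move=> zI; rewrite /U/= foldE.
have near_int (f1 f2 : R * 'rV[R]_n.+1 -> R) z : spacetime_interior z ->
    (forall y, spacetime_interior y -> f1 y = f2 y) -> \near z, f1 z = f2 z.
  move=> zI fE; have : nbhs z spacetime_interior.
    by apply: open_nbhs_nbhs; split => //; exact: open_spacetime_interior.
  by apply: filterS => y /fE.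
have cU : continuous U by exact: continuous_fold.
have dU k z : spacetime_interior z -> is_derive z (coord_dir k) U (g k z).
  (* The interior is open, so [U] and [u] agree near [z] and have the same derivatives there. *)
  move=> zI; apply: (@near_eq_is_derive _ _ _ u).
    by apply: near_int => // y yI; rewrite UE.
  have [+ _] := du k => /(_ z zI) duz.
  by split => //; rewrite -(gP k).2.
have ddU k z : spacetime_interior z -> is_derive z (coord_dir k) (g k) (h k z).
  move=> zI; apply: (@near_eq_is_derive _ _ _ (partial k u)).
    by apply: near_int => // y yI; rewrite (gP k).2.
  have [+ _] := ddu k k => /(_ z zI) duz.
  by split => //; rewrite -(hP k).2.
exists U, g, h; split => //.
- by move=> k; have [] := gP k.
- by move=> k; have [] := hP k.
- move=> z zI; case: z zI => t x zI; have [t0 x0] := zI.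
  rewrite UE// -pde// -!(hP _).2// -(gP _).2//.
  congr (_ - _ + _); rewrite /laplacian; apply: eq_bigr => i _.
  by rewrite (hP (Some i)).2.
- move=> t x t0 x0; rewrite /U/= fold_spacetime_id/=; [|exact: ltW|by rewrite x0].
  by apply: bnd => //; exact: half_space_boundaryP.
- by move=> x x0; rewrite /U/= fold_spacetime_id/= ?lexx//; [exact: init|exact: ltW].
- move=> x x0.
  have cpair : continuous (fun s : R => (s, x)).
    by apply: continuous_pair => s; [exact: cvg_id|exact: cvg_cst].
  have := @right_derive_lim R (fun s => U (s, x)) (fun s => g None (s, x)) 1 ltr01.
  have cg : continuous (fun s => g None (s, x)).
    move=> s; apply: (@continuous_comp _ _ _ (fun s : R => (s, x))).
      exact: cpair.
    exact: (gP None).1.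
  have cUs : continuous (fun s => U (s, x)).
    move=> s; apply: (@continuous_comp _ _ _ (fun s : R => (s, x))).
      exact: cpair.
    exact: cU.
  move=> /(_ cUs cg) lim.
  (* The right derivative of [U] at time 0 is [g None (0, x)]; uniqueness of limits then identifies
     it with [u1 x]. *)
  have {}lim : h^-1 * (U (h, x) - U (0, x)) @[h --> 0^'+] --> g None (0, x).
    apply: lim => s; rewrite in_itv/= => /andP[s0 _].
    apply: (@is_derive_line _ _ U (fun s => (s, x)) (coord_dir None)).
      by move=> h1; congr pair => /=; rewrite ?scaler0 ?add0r// [h1 *: 1]mulr1.
    exact: dU.
  apply: (cvg_unique _ lim) => //.
  have E0 : U (0, x) = u (0, x).
    by rewrite /U/= fold_spacetime_id/= ?lexx//; exact: ltW.
  have := init1 x x0; apply: cvg_trans; apply: near_eq_cvg.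
  near=> h1; rewrite E0 UE//; split => //=.
Unshelve. all: by end_near. Qed.

(** * The parabolic cylinders *)

Section box.
Context {R : realType} {n : nat}.
Notation space := 'rV[R]_n.+1.
Notation spacetime := (measurableTypeR R * space)%type.
Local Notation leb := (@lebesgue_measure R).
Local Notation lebn := (@lebesgue_rV R n.+1).
Implicit Types (T : R) (i : 'I_n.+1).

Definition side T i : set R := `]if i == ord_max then 0 else - T, T[.
Definition box T : set space := [set x | forall i, side T i (x ord0 i)].
Definition cylinder T : set spacetime := `]0, T ^+ 2[ `*` box T.

Lemma measurable_side T i : measurable (side T i : set (measurableTypeR R)).
Proof. exact: measurable_itv. Qed.

Lemma measurable_box T : measurable (box T).
Proof.
rewrite (_ : box T = \bigcap_(i in [set: 'I_n.+1])
      ((fun x : space => x ord0 i) @^-1` side T i)).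
  apply: fin_bigcap_measurable => // i _.
  rewrite -[X in measurable X]setTI; apply: measurable_rV_coord => //.
  exact: measurable_side.
by apply/seteqP; split=> x /= h i; [move=> _; exact: h | exact: h].
Qed.

Lemma measurable_box_cylinder T : measurable (cylinder T).
Proof. by apply: measurableX; [exact: measurable_itv|exact: measurable_box]. Qed.

Lemma side_ge0 T i s : side T i s -> 0 < T.
Proof.
rewrite /side/= in_itv/=; case: ifP => _ /andP[]; first exact: lt_trans.
by move=> a b; have := lt_trans a b; lra.
Qed.

Lemma box_half_space T x : box T x -> half_space x.
Proof.
move=> /(_ ord_max); rewrite /side/= eqxx in_itv/= => /andP[x0 _]; exact: x0.
Qed.

Lemma cylinder_interior T (z : spacetime) : cylinder T z -> spacetime_interior z.
Proof.
move=> [z1 /box_half_space z2]; split => //.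
by move: z1; rewrite /= in_itv/= => /andP[].
Qed.

(** Time contributes [T^2] and each of the [n+1] sides at most [2 T]. *)
Lemma measure_box_cylinder T : 0 < T ->
  ((leb \x lebn) (cylinder T) <= (2 ^+ n.+1 * T ^+ (n.+3))%:E)%E.
Proof.
move=> T0; rewrite /cylinder product_measure1E//; last exact: measurable_box.
rewrite lebesgue_rV_box; last by move=> i; exact: measurable_side.
have IE : leb `]0, T ^+ 2[ = (T ^+ 2)%:E.
  by rewrite lebesgue_measure_itv/= lte_fin exprn_gt0// oppr0 adde0.
rewrite [X in (X * _)%E]IE.
have sideE i : leb (side T i) = (T - (if i == ord_max then 0 else - T))%:E.
  have loT : (if i == ord_max then 0 else - T) < T by case: ifP => _ //; lra.
  by rewrite /side lebesgue_measure_itv/= lte_fin loT.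
under eq_bigr do rewrite sideE.
rewrite prodEFin -EFinM lee_fin.
have -> : 2 ^+ n.+1 * T ^+ n.+3 = T ^+ 2 * \prod_(i < n.+1) (2 * T).
  by rewrite prodr_const card_ord exprMn [RHS]mulrCA -exprD.
rewrite ler_pM2l ?exprn_gt0//; apply: ler_prod => i _.
by case: ifP => _; lra.
Qed.

(** The cylinder has finite measure and lies in a compact set, on which [f] is bounded. *)
Lemma continuous_integrable_cylinder T (f : R * space -> R) : 0 < T ->
  continuous f -> (leb \x lebn)%E.-integrable (cylinder T) (EFin \o f).
Proof.
move=> T0 cf; apply: measurable_bounded_integrable.
- exact: measurable_box_cylinder.
- by apply: le_lt_trans (measure_box_cylinder T0) _; rewrite ltry.
- by apply: measurable_funTS; exact: continuous_measurable_prod_rV.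
have cK : compact (`[0, T ^+ 2] `*` [set x : space | forall i, [set` `[- T, T]] (x ord0 i)]).
  apply: compact_setX; first exact: segment_compact.
  by apply: (@rV_compact R _ (fun=> [set` `[- T, T]])) => i; exact: segment_compact.
have /compact_bounded [M [Mr MP]] :=
  continuous_compact (continuous_subspaceT cf) cK.
exists M; split => // e Me z [z1 z2]; apply: (MP e Me); exists z => //.
split; first by move: z1; apply: subset_itv_oo_cc.
move=> i; move: (z2 i); rewrite /side/= !in_itv/= => /andP[z2i /ltW ->].
rewrite andbT; apply: le_trans (ltW z2i).
by case: ifP => _ //; lra.
Qed.
End box.

(** * Green's formulas on the cylinder and the weak formulation *)

Section green.
Context {R : realType} {n : nat} {p : R} {u0 u1 : 'rV[R]_n.+1 -> R}.
Context {U : R * 'rV[R]_n.+1 -> R} {G H : option 'I_n.+1 -> R * 'rV[R]_n.+1 -> R}.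
Hypothesis sol : smooth_solution p u0 u1 U G H.
Notation space := 'rV[R]_n.+1.
Notation spacetime := (measurableTypeR R * space)%type.
Local Notation leb := (@lebesgue_measure R).
Local Notation lebn := (@lebesgue_rV R n.+1).
Local Notation mu := (leb \x lebn)%E.

Let inner (i : 'I_n.+1) (t : R) (x : space) (s : R) := (t, row_set i s x).

Let inner_cont i t x : continuous (inner i t x).
Proof.
by apply: continuous_pair => s; [exact: cvg_cst|exact: continuous_row_set].
Qed.

Lemma continuous_space_line (f : R * space -> R) i t x :
  continuous f -> continuous (fun s => f (t, row_set i s x)).
Proof.
move=> cf s; apply: (@continuous_comp _ _ _ (inner i t x)).
  exact: inner_cont.
exact: cf.
Qed.

Lemma is_derive_space_line (f : R * space -> R) i t x s d :
  is_derive (t, row_set i s x) (coord_dir (Some i)) f d ->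
  is_derive s 1 (fun s => f (t, row_set i s x)) d.
Proof.
apply: (@is_derive_line _ _ f (inner i t x)) => h.
congr pair => /=; first by rewrite scaler0 add0r.
by rewrite !row_setE addrCA -scalerDl addrA.
Qed.

Lemma continuous_time_line (f : R * space -> R) x :
  continuous f -> continuous (fun s => f (s, x)).
Proof.
move=> cf s; apply: (@continuous_comp _ _ _ (fun s : R => (s, x))).
  by apply: continuous_pair => {}s; [exact: cvg_id|exact: cvg_cst].
exact: cf.
Qed.

Lemma is_derive_time_line (f : R * space -> R) x s d :
  is_derive (s, x) (coord_dir None) f d ->
  is_derive s 1 (fun s => f (s, x)) d.
Proof.
apply: (@is_derive_line _ _ f (fun s => (s, x))) => h.
by congr pair => /=; rewrite ?scaler0 ?add0r// [h *: 1]mulr1.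
Qed.

Definition weight_but (q : 'I_n.+1 -> {poly R}) i (x : space) : R :=
  \prod_(j | j != i) (q j).[x ord0 j].

Definition weight (q : 'I_n.+1 -> {poly R}) (x : space) : R :=
  \prod_j (q j).[x ord0 j].

Lemma continuous_coord (i : 'I_n.+1) (r : {poly R}) :
  continuous (fun z : R * space => r.[z.2 ord0 i]).
Proof.
move=> z; apply: (@continuous_comp _ _ _ (fun z : R * space => z.2 ord0 i) (horner r)).
  apply: (@continuous_comp _ _ _ snd (fun x : space => x ord0 i)).
    exact: cvg_snd.
  exact: coord_continuous.
exact: continuous_horner.
Qed.

Lemma continuous_weight_but q i :
  continuous (fun z : R * space => weight_but q i z.2).
Proof.
have mulc : continuous (fun x : R * R => x.1 * x.2) by exact: mul_continuous.
have := @continuous_big R _ *%R 1 (predC1 i) mulc (R * space)%type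
  (index_enum 'I_n.+1) (fun j z => (q j).[z.2 ord0 j]).
apply => j _; exact: continuous_coord.
Qed.

Lemma continuous_weight q :
  continuous (fun z : R * space => weight q z.2).
Proof.
have mulc : continuous (fun x : R * R => x.1 * x.2) by exact: mul_continuous.
have := @continuous_big R _ *%R 1 predT mulc (R * space)%type
  (index_enum 'I_n.+1) (fun j z => (q j).[z.2 ord0 j]).
apply => j _; exact: continuous_coord.
Qed.

Lemma continuous_time_poly (r : {poly R}) :
  continuous (fun z : R * space => r.[z.1]).
Proof.
move=> z; apply: (@continuous_comp _ _ _ fst (horner r)).
  exact: cvg_fst.
exact: continuous_horner.
Qed.

(** By Fubini it suffices to integrate along lines in direction [i], where only end-point terms
    remain. At [T] both [q i] and its derivative vanish. At the lower end [q i] vanishes, and the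
    term in [U] is killed by the derivative of [q i] or, for [i = ord_max], by the boundary
    condition. *)
Lemma integral_space_green (T : R) (q0 : {poly R}) (q : 'I_n.+1 -> {poly R}) i :
  0 < T -> (q i).[T] = 0 -> (q i)^`().[T] = 0 ->
  (q i).[if i == ord_max then 0 else - T] = 0 ->
  (i != ord_max -> (q i)^`().[- T] = 0) ->
  (\int[mu]_(z in cylinder T) (q0.[z.1] * weight_but q i z.2 *
    ((q i).[z.2 ord0 i] * H (Some i) z
     - (q i)^`()^`().[z.2 ord0 i] * U z))%:E = 0)%E.
Proof.
move=> T0 qT dqT qlo dqlo.
set f := fun z : R * space => q0.[z.1] * weight_but q i z.2 *
    ((q i).[z.2 ord0 i] * H (Some i) z - (q i)^`()^`().[z.2 ord0 i] * U z).
have cf : continuous f.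
  move=> z; apply: cvgM.
    apply: cvgM; [exact: continuous_time_poly|exact: continuous_weight_but].
  apply: cvgB; (apply: cvgM; first exact: continuous_coord).
    exact: smooth_cont2 sol _ _.
  exact: smooth_cont sol _.
rewrite integral_mkcond/=.
have intf : mu.-integrable setT ((EFin \o f) \_ (cylinder T)).
  apply/integrable_restrict; rewrite ?setTI//; first exact: measurable_box_cylinder.
  exact: continuous_integrable_cylinder.
rewrite -integral12_prod_meas1//.
rewrite -(@integral0 _ _ _ leb setT); apply: ae_eq_integral => //.
  exact: (measurable_fubini_F intf).
apply: filterS (ae_integrable1 intf) => t intt _.
apply: (integral_row_set0 (i := i) intt) => x.
(* If the time or another coordinate is out of range, the line misses the cylinder and the integrand
   is 0 along it. *)
have [[t0 xj]|out] := pselect ((t \in `]0, T ^+ 2[) /\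
    forall j, j != i -> side T j (x ord0 j)); last first.
  apply: integral0_eq => s _; rewrite patchE memNset//= => -[/= t0 xs].
  apply: out; split => // j ji; have := xs j.
  by rewrite mxE (negbTE ji).
(* Along the line the time factor and the factors of the other coordinates are constant, so they
   merge into the polynomial. *)
pose c := q0.[t] * weight_but q i x.
under eq_integral => s _.
  rewrite (_ : _ (t, _) = ((fun s => ((c *: q i).[s] * H (Some i) (t, row_set i s x)
    - (c *: q i)^`()^`().[s] * U (t, row_set i s x))%:E) \_ (side T i)) s).
    over.
  rewrite !patchE; case: ifPn => [|nin].
    rewrite inE => -[/= _ /(_ i)]; rewrite mxE eqxx => si; rewrite mem_set//.
    rewrite /f/=; congr EFin; rewrite mxE eqxx !derivZ !hornerZ /c.
    have -> : weight_but q i (row_set i s x) = weight_but q i x.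
      by apply: eq_bigr => j ji; rewrite mxE (negbTE ji).
    ring.
  rewrite memNset// => si; move: nin; rewrite notin_setE; apply; split => //= j.
  by rewrite mxE; case: eqP => [->//|/eqP ji]; exact: xj.
rewrite -integral_mkcond.
have loT : (if i == ord_max then 0 else - T) < T by case: ifP => _ //; lra.
have intr s : s \in `](if i == ord_max then 0 else - T), T[ ->
    spacetime_interior (t, row_set i s x).
  move=> si; apply: (@cylinder_interior _ _ T); split => //= j.
  by rewrite mxE; case: eqP => [->//|/eqP ji]; exact: xj.
have cU : continuous (fun s => U (t, row_set i s x)).
  by apply: continuous_space_line; exact: smooth_cont sol.
have cG : continuous (fun s => G (Some i) (t, row_set i s x)).
  by apply: continuous_space_line; exact: smooth_cont1 sol _.
have cH : continuous (fun s => H (Some i) (t, row_set i s x)).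
  by apply: continuous_space_line; exact: smooth_cont2 sol _.
apply: (etrans (green_formula1 (c *: q i) loT cU cG cH
    (fun s si => is_derive_space_line (smooth_deriv sol (Some i) (intr s si)))
    (fun s si => is_derive_space_line (smooth_deriv2 sol (Some i) (intr s si))))).
rewrite !derivZ !hornerZ qT dqT qlo !mulr0 !mul0r subr0 !sub0r opprK.
case: ifPn => [/eqP iN|iN]; last by rewrite dqlo// mulr0 mul0r.
rewrite (smooth_bnd sol) ?mulr0//.
  by move: t0; rewrite in_itv/= => /andP[].
by rewrite iN mxE eqxx.
Qed.

(** Only the end [t = 0] contributes: [q0] has value 1 and slope 0 there, so Green's formula leaves
    [U + G None], which is [u0 + u1]. *)
Lemma integral_time_green (T : R) (q0 : {poly R}) (q : 'I_n.+1 -> {poly R}) :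
  0 < T -> q0.[T ^+ 2] = 0 -> q0^`().[T ^+ 2] = 0 ->
  q0.[0] = 1 -> q0^`().[0] = 0 ->
  (\int[mu]_(z in cylinder T) (weight q z.2 *
    ((q0^`()^`().[z.1] - q0^`().[z.1]) * U z
     - q0.[z.1] * (H None z + G None z)))%:E =
   \int[lebn]_(x in box T) (weight q x * (u0 x + u1 x))%:E)%E.
Proof.
move=> T0 qT dqT q00 dq00.
set f := fun z : R * space => weight q z.2 *
    ((q0^`()^`().[z.1] - q0^`().[z.1]) * U z - q0.[z.1] * (H None z + G None z)).
have cf : continuous f.
  move=> z; apply: cvgM; first exact: continuous_weight.
  apply: cvgB; apply: cvgM.
  - by apply: cvgB; exact: continuous_time_poly.
  - exact: smooth_cont sol _.
  - exact: continuous_time_poly.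
  - by apply: cvgD; [exact: smooth_cont2 sol _ _|exact: smooth_cont1 sol _ _].
rewrite integral_mkcond/= [RHS]integral_mkcond.
have intf : mu.-integrable setT ((EFin \o f) \_ (cylinder T)).
  apply/integrable_restrict; rewrite ?setTI//; first exact: measurable_box_cylinder.
  exact: continuous_integrable_cylinder.
rewrite -integral21_prod_meas1//; apply: eq_integral => x _; rewrite /fubini_G.
rewrite [RHS]patchE; case: ifPn => [|xB]; last first.
  apply: integral0_eq => t _; rewrite patchE memNset//= => -[/= _].
  by move: xB; rewrite notin_setE.
rewrite inE => xB.
(* The sign matches the integrand with Green's formula, and the lower end-point term then comes out
   as [weight q x * (u0 x + u1 x)]. *)
pose c := - weight q x.
under eq_integral => t _.
  rewrite (_ : _ (t, _) = ((fun s => ((c *: q0).[s] * (H None (s, x) + G None (s, x))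
    - ((c *: q0)^`()^`().[s] - (c *: q0)^`().[s]) * U (s, x))%:E) \_ `]0%R, (T ^+ 2)%R[) t).
    over.
  rewrite !patchE; case: ifPn => [|nin].
    rewrite inE => -[/= ti _]; rewrite mem_set//.
    rewrite /f/=; congr EFin; rewrite !derivZ !hornerZ /c; ring.
  by rewrite memNset// => ti; move: nin; rewrite notin_setE; apply; split.
rewrite -integral_mkcond.
have T20 : 0 < T ^+ 2 by rewrite exprn_gt0.
have intr t : t \in `]0, T ^+ 2[ -> spacetime_interior (t, x).
  by move=> ti; apply: (@cylinder_interior _ _ T); split.
have cU : continuous (fun s => U (s, x)).
  by apply: continuous_time_line; exact: smooth_cont sol.
have cG : continuous (fun s => G None (s, x)).
  by apply: continuous_time_line; exact: smooth_cont1 sol _.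
have cH : continuous (fun s => H None (s, x)).
  by apply: continuous_time_line; exact: smooth_cont2 sol _.
apply: (etrans (green_formula1_damped (c *: q0) T20 cU cG cH
    (fun t ti => is_derive_time_line (smooth_deriv sol None (intr t ti)))
    (fun t ti => is_derive_time_line (smooth_deriv2 sol None (intr t ti))))).
have xH := box_half_space xB.
rewrite !derivZ !hornerZ qT dqT q00 dq00 (smooth_init sol)// (smooth_init1 sol)//.
by congr EFin; rewrite /c; ring.
Qed.

Lemma Rintegral_cylinder_sum (T : R) (I : Type) (s : seq I)
    (f : I -> R * space -> R) : 0 < T -> (forall i, continuous (f i)) ->
  (\int[mu]_(z in cylinder T) (\sum_(i <- s) f i z))%R =
  \sum_(i <- s) (\int[mu]_(z in cylinder T) f i z)%R.
Proof.
move=> T0 cf.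
have mT := @measurable_box_cylinder R n T.
have cs r : continuous (fun z : R * space => \sum_(i <- r) f i z).
  have addc : continuous (fun x : R * R => x.1 + x.2) by exact: add_continuous.
  by have := @continuous_big R _ +%R 0 predT addc _ r f; apply.
elim: s => [|i s IH].
  rewrite big_nil; under eq_Rintegral do rewrite big_nil.
  by rewrite Rintegral_cst// mul0r.
rewrite big_cons -IH -RintegralD//; last 2 first.
- exact: continuous_integrable_cylinder.
- exact: continuous_integrable_cylinder.
by apply: eq_Rintegral => z _; rewrite big_cons.
Qed.

(* The formal adjoint of the damped wave operator applied to the test function
   [q0(t) * weight q x]. *)
Definition adj (q0 : {poly R}) (q : 'I_n.+1 -> {poly R}) (z : R * space) : R :=
  weight q z.2 * (q0^`()^`().[z.1] - q0^`().[z.1]) -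
  \sum_i q0.[z.1] * weight_but q i z.2 * (q i)^`()^`().[z.2 ord0 i].

Lemma continuous_adj q0 q : continuous (adj q0 q).
Proof.
move=> z; apply: cvgB.
  apply: cvgM; first exact: continuous_weight.
  by apply: cvgB; exact: continuous_time_poly.
have addc : continuous (fun x : R * R => x.1 + x.2) by exact: add_continuous.
have := @continuous_big R _ +%R 0 predT addc (R * space)%type
  (index_enum 'I_n.+1) (fun i z => q0.[z.1] * weight_but q i z.2 *
  (q i)^`()^`().[z.2 ord0 i]); apply => i _ {}z.
apply: cvgM; last exact: continuous_coord.
by apply: cvgM; [exact: continuous_time_poly|exact: continuous_weight_but].
Qed.

(** The equation is multiplied by the test function and its derivatives are moved onto that
    function, at the cost of the data term. *)
Lemma weak_formulation (T : R) (q0 : {poly R}) (q : 'I_n.+1 -> {poly R}) :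
  0 < T -> q0.[T ^+ 2] = 0 -> q0^`().[T ^+ 2] = 0 ->
  q0.[0] = 1 -> q0^`().[0] = 0 ->
  (forall i, (q i).[T] = 0 /\ (q i)^`().[T] = 0) ->
  (forall i, (q i).[if i == ord_max then 0 else - T] = 0) ->
  (forall i, i != ord_max -> (q i)^`().[- T] = 0) ->
  mu.-integrable (cylinder T)
    (fun z => (q0.[z.1] * weight q z.2 * `|U z| `^ p)%:E) /\
  ((\int[mu]_(z in cylinder T) (q0.[z.1] * weight q z.2 * `|U z| `^ p))%R +
  (\int[lebn]_(x in box T) (weight q x * (u0 x + u1 x)))%R =
  (\int[mu]_(z in cylinder T) (U z * adj q0 q z))%R).
Proof.
move=> T0 qT dqT q00 dq00 qiT qilo dqilo.
have mT := @measurable_box_cylinder R n T.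
pose tau := fun z : R * space => weight q z.2 *
    ((q0^`()^`().[z.1] - q0^`().[z.1]) * U z - q0.[z.1] * (H None z + G None z)).
pose sig := fun i (z : R * space) => q0.[z.1] * weight_but q i z.2 *
    ((q i).[z.2 ord0 i] * H (Some i) z - (q i)^`()^`().[z.2 ord0 i] * U z).
have ctau : continuous tau.
  move=> z; apply: cvgM; first exact: continuous_weight.
  apply: cvgB; apply: cvgM.
  - by apply: cvgB; exact: continuous_time_poly.
  - exact: smooth_cont sol _.
  - exact: continuous_time_poly.
  - by apply: cvgD; [exact: smooth_cont2 sol _ _|exact: smooth_cont1 sol _ _].
have csig i : continuous (sig i).
  move=> z; apply: cvgM.
    apply: cvgM; [exact: continuous_time_poly|exact: continuous_weight_but].
  apply: cvgB; (apply: cvgM; first exact: continuous_coord).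
    exact: smooth_cont2 sol _ _.
  exact: smooth_cont sol _.
have cssig : continuous (fun z => \sum_i sig i z).
  have addc : continuous (fun x : R * R => x.1 + x.2) by exact: add_continuous.
  by have := @continuous_big R _ +%R 0 predT addc _ (index_enum 'I_n.+1) sig; apply.
have cUadj : continuous (fun z => U z * adj q0 q z).
  by move=> z; apply: cvgM; [exact: smooth_cont sol _|exact: continuous_adj].
(* Pointwise form of the identity, from the equation in the interior. Its right side is continuous
   on all of spacetime, which also yields integrability of the left side. *)
have key z : cylinder T z -> q0.[z.1] * weight q z.2 * `|U z| `^ p =
    U z * adj q0 q z - (tau z + \sum_i sig i z).
  move=> /cylinder_interior zI; rewrite -(smooth_pde sol)// /tau /sig /adj.
  have -> : \sum_i q0.[z.1] * weight_but q i z.2 *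
      ((q i).[z.2 ord0 i] * H (Some i) z - (q i)^`()^`().[z.2 ord0 i] * U z) =
    \sum_i q0.[z.1] * weight q z.2 * H (Some i) z - U z * \sum_i
       q0.[z.1] * weight_but q i z.2 * (q i)^`()^`().[z.2 ord0 i].
    rewrite mulr_sumr -sumrB; apply: eq_bigr => i _.
    rewrite /weight (bigD1 i)//= -/(weight_but q i z.2); ring.
  rewrite -mulr_sumr; set S1 := \sum_i H _ _; set S2 := \sum_i _.
  ring.
have ctot : continuous (fun z => U z * adj q0 q z - (tau z + \sum_i sig i z)).
  move=> z; apply: cvgB; first exact: cUadj.
  by apply: cvgD; [exact: ctau|exact: cssig].
have itau := continuous_integrable_cylinder T0 ctau.
have issig := continuous_integrable_cylinder T0 cssig.
have iU := continuous_integrable_cylinder T0 cUadj.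
split.
  apply: eq_integrable (continuous_integrable_cylinder T0 ctot) => // z.
  by rewrite inE /= => /key ->.
have -> : (\int[mu]_(z in cylinder T) (q0.[z.1] * weight q z.2 * `|U z| `^ p))%R =
    (\int[mu]_(z in cylinder T) (U z * adj q0 q z - (tau z + \sum_i sig i z)))%R.
  by apply: eq_Rintegral => z; rewrite inE => /key.
rewrite RintegralB//; last by apply: (integrableD _ itau issig).
rewrite RintegralD// Rintegral_cylinder_sum//.
(* Each [sig i] integrates to 0, and [tau] to the data term. *)
rewrite big1 => [|i _]; last first.
  have [qi1 qi2] := qiT i.
  by rewrite /Rintegral integral_space_green// => /dqilo.
rewrite addr0 [X in _ - X]/Rintegral (integral_time_green q T0 qT dqT q00 dq00).
by rewrite -/(Rintegral _ _ _) subrK.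
Qed.
End green.

(* The threshold [M * T^-(n+2)] for [X] makes [X^(p-1)] dominate
   [M^(p-1) * T^-2] precisely for [p] at most the critical exponent. *)
Lemma young_split (R : realType) (n : nat) (p C M T X : R) :
  1 < p -> p <= 1 + 2 / (n.+1%:R + 1) -> 0 <= C -> 0 < M -> 1 <= T -> 0 <= X ->
  X * (C * T ^- 2) <= C * M `^ (- (p - 1)) * X `^ p + C * M * T ^- (n.+4).
Proof.
move=> p1 pn C0 M0 T1 X0.
have T0 : 0 < T by exact: lt_le_trans T1.
have TV k : 0 < T ^- k by rewrite invr_gt0 exprn_gt0.
(* Below the threshold the constant error alone bounds the left side; above it the term in [X^p]
   does. *)
have [XM|MX] := ltP X (M * T ^- n.+2).
  rewrite ler_wpDl ?mulr_ge0 ?powR_ge0//.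
  rewrite mulrCA -mulrA ler_wpM2l//.
  apply: le_trans (ler_wpM2r (ltW (TV 2)) (ltW XM)) _.
  by rewrite -mulrA -invfM -exprD addn2.
rewrite ler_wpDr ?mulr_ge0 ?(ltW (TV _)) ?(ltW M0)//.
have XX : 0 < X by apply: lt_le_trans MX; rewrite mulr_gt0.
rewrite mulrCA -mulrA ler_wpM2l//.
have -> : X `^ p = X * X `^ (p - 1).
  by rewrite -{2}(powRr1 X0) -powRD ?(gt_eqF XX) ?implybT// addrCA subrr addr0.
rewrite mulrCA ler_wpM2l// powRN ler_pdivlMl ?powR_gt0//.
have : (M * T ^- n.+2) `^ (p - 1) <= X `^ (p - 1).
  by apply: ge0_ler_powR; rewrite ?nnegrE ?mulr_ge0 ?(ltW (TV _)) ?(ltW M0)//; lra.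
apply: le_trans; rewrite powRM ?(ltW (TV _)) ?(ltW M0)//.
rewrite ler_wpM2l ?powR_ge0//.
rewrite -!powR_mulrn ?(ltW T0)// -!powRN -powRrM; apply: ler_powR => //.
rewrite mulNr lerN2.
have n2 : 0 < n.+2%:R :> R by rewrite ltr0n.
(* The upper bound on [p] enters as [(n+2) (p-1) <= 2], which compares powers of [T] because
   [T >= 1]. *)
have : p - 1 <= 2 / n.+2%:R by rewrite lerBlDl -[n.+2%:R]natr1.
by rewrite ler_pdivlMr// mulrC.
Qed.

(** * Polynomial cut-offs and their derivatives *)

Section test_polynomial.
Context {R : realType} (m : nat).
Implicit Types c s : R.

(** Two derivatives of the power [m+2] leave the power [m]. Being even, the polynomial has slope 0
    at the origin. *)
Definition bump_poly c : {poly R} := (1 - c *: 'X ^+ 2) ^+ m.+2.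

Lemma bumpE c s : (bump_poly c).[s] = (1 - c * s ^+ 2) ^+ m.+2.
Proof. by rewrite /bump_poly !hornerE. Qed.

Let lin c : {poly R} := 1 - c *: 'X ^+ 2.

Let deriv_lin c k :
  (lin c ^+ k.+1)^`() = (- (2 * k.+1%:R * c)) *: ('X * lin c ^+ k).
Proof.
rewrite deriv_exp /= /lin derivB derivC derivZ derivXn sub0r/= expr1.
rewrite -!mul_polyC !rmorphN !rmorphM !rmorph_nat /=; ring.
Qed.

Lemma deriv_bump c s :
  (bump_poly c)^`().[s] = - (2 * m.+2%:R * c * s) * (1 - c * s ^+ 2) ^+ m.+1.
Proof. by rewrite deriv_lin /lin !hornerE/=; ring. Qed.

Lemma deriv2_bump c s : (bump_poly c)^`()^`().[s] = (1 - c * s ^+ 2) ^+ m *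
  (- (2 * m.+2%:R * c) * (1 - c * s ^+ 2)
   + 4 * m.+2%:R * m.+1%:R * c * (c * s ^+ 2)).
Proof.
rewrite deriv_lin derivZ derivM derivX deriv_lin /lin !hornerE/= exprS; ring.
Qed.

Lemma deriv_Xbump c s : ('X * bump_poly c)^`().[s] =
  (bump_poly c).[s] + s * (bump_poly c)^`().[s].
Proof. by rewrite derivM derivX !hornerE. Qed.

(** The polynomial is odd, so its second derivative keeps a factor [s]; this is what keeps the
    adjoint bounded by a multiple of the weight [x_N]. *)
Lemma deriv2_Xbump c s : ('X * bump_poly c)^`()^`().[s] =
  s * ((1 - c * s ^+ 2) ^+ m * (- (6 * m.+2%:R * c) * (1 - c * s ^+ 2)
   + 4 * m.+2%:R * m.+1%:R * c * (c * s ^+ 2))).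
Proof.
rewrite derivM derivX mul1r derivD (derivM 'X) derivX mul1r.
rewrite !(hornerD, hornerM, hornerX) deriv2_bump deriv_bump exprS; ring.
Qed.

(** Large enough to dominate both coefficients [6 (m+2)] and [4 (m+2) (m+1)] of the second
    derivatives. *)
Definition bump_const : R := 6 * m.+2%:R ^+ 2.

(** The two terms have opposite signs and are at most the fractions [1 - a] and [a] of the right
    side. The value of [k] is [2 (m+2)] for the plain cut-off and [6 (m+2)] for the one multiplied
    by ['X]. *)
Lemma bump_bracket (k c a : R) : 0 <= k <= 6 * m.+2%:R -> 0 <= c -> 0 <= a <= 1 ->
  `| - (k * c) * (1 - a) + 4 * m.+2%:R * m.+1%:R * c * a | <= bump_const * c.
Proof.
move=> /andP[k0 k6] c0 /andP[a0 a1].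
have m1 : 1 <= m.+2%:R :> R by rewrite ler1n.
have mm : m.+1%:R <= m.+2%:R :> R by rewrite ler_nat.
have m0 : 0 <= m.+1%:R :> R by [].
have h1 : 0 <= k * c * (1 - a) <= bump_const * c * (1 - a).
  rewrite !mulr_ge0 ?subr_ge0//= ler_wpM2r ?subr_ge0// ler_wpM2r//.
  by apply: le_trans k6 _; rewrite /bump_const ler_pM2l// expr2 ler_peMr.
have h2 : 0 <= 4 * m.+2%:R * m.+1%:R * c * a <= bump_const * c * a.
  rewrite !mulr_ge0//= ler_wpM2r// ler_wpM2r// /bump_const expr2 mulrA.
  by apply: ler_pM => //; rewrite ?mulr_ge0// ler_wpM2r// ler_nat.
move/andP: h1 => [h1 h1']; move/andP: h2 => [h2 h2'].
have E : bump_const * c * (1 - a) + bump_const * c * a = bump_const * c by ring.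
by rewrite ler_norml; apply/andP; split; lra.
Qed.

End test_polynomial.

(** * The test function and the bound on its adjoint *)

Section test_function.
Context {R : realType} {n : nat} (m : nat).
Notation space := 'rV[R]_n.+1.
Implicit Types (T : R) (i : 'I_n.+1).

Definition time_poly T : {poly R} := bump_poly m (T ^- 4).
Definition space_poly T i : {poly R} :=
  if i == ord_max then 'X * bump_poly m (T ^- 2) else bump_poly m (T ^- 2).

Definition time_cut T (t : R) : R := 1 - T ^- 4 * t ^+ 2.
Definition space_cut T (s : R) : R := 1 - T ^- 2 * s ^+ 2.
Definition cutoff T (z : R * space) : R :=
  time_cut T z.1 * \prod_i space_cut T (z.2 ord0 i).

Lemma time_cut_itv T t : 0 < T -> t \in `]0, T ^+ 2[ -> 0 < time_cut T t <= 1.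
Proof.
move=> T0; rewrite in_itv/= => /andP[t0 tT]; apply/andP; split.
  rewrite subr_gt0 mulrC ltr_pdivrMr ?exprn_gt0// mul1r.
  by rewrite (_ : 4 = 2 * 2)%N// exprM ltrXn2r// ?ltW// exprn_ge0// ltW.
by rewrite gerBl mulr_ge0 ?invr_ge0 ?exprn_ge0// ltW.
Qed.

Lemma space_cut_itv T i s : 0 < T -> side T i s -> 0 < space_cut T s <= 1.
Proof.
move=> T0 si; have : - T < s < T.
  by move: si; rewrite /side/= in_itv/=; case: ifP => _ // /andP[s0 ->]; lra.
rewrite -ltr_norml => sT; apply/andP; split.
  rewrite subr_gt0 mulrC ltr_pdivrMr ?exprn_gt0// mul1r -real_normK ?num_real//.
  by rewrite ltrXn2r// ltW.
by rewrite gerBl mulr_ge0 ?invr_ge0 ?sqr_ge0.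
Qed.

Lemma prod_itv01 (I : Type) (r : seq I) (P : pred I) (f : I -> R) :
  (forall j, P j -> 0 < f j <= 1) -> 0 < \prod_(j <- r | P j) f j <= 1.
Proof.
move=> f01; elim/big_ind : _ => //; first by rewrite ltr01 lexx.
move=> x y /andP[x0 x1] /andP[y0 y1].
by rewrite mulr_gt0//= mulr_ile1 ?(ltW x0) ?(ltW y0).
Qed.

Lemma cutoff_itv T z : cylinder T z -> 0 < cutoff T z <= 1.
Proof.
move=> [/= zt zx]; have T0 := side_ge0 (zx ord_max).
have /andP[a0 a1] := time_cut_itv T0 zt.
have /andP[b0 b1] : 0 < \prod_i space_cut T (z.2 ord0 i) <= 1.
  by apply: prod_itv01 => i _; exact: space_cut_itv (zx i).
by rewrite /cutoff mulr_gt0//= mulr_ile1 ?(ltW a0) ?(ltW b0).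
Qed.

(** The weight [x_N] written as a product over all coordinates, so that every direction is handled
    by the same formula. *)
Let factor i : R -> R := fun s => if i == ord_max then s else 1.

Let prod_factor (x : space) : \prod_i factor i (x ord0 i) = x ord0 ord_max.
Proof.
rewrite (bigD1 ord_max)//= big1 ?mulr1 /factor ?eqxx// => i /negbTE.
by move=> ->.
Qed.

Let space_polyE T i s :
  (space_poly T i).[s] = factor i s * space_cut T s ^+ m.+2.
Proof.
rewrite /space_poly /factor; case: ifP => _; last by rewrite bumpE mul1r.
by rewrite hornerM hornerX bumpE.
Qed.

Lemma weight_space_poly T x : weight (space_poly T) x =
  x ord0 ord_max * (\prod_i space_cut T (x ord0 i)) ^+ m.+2.
Proof.
rewrite /weight; under eq_bigr do rewrite space_polyE.
by rewrite big_split/= prod_factor prodrXl.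
Qed.

Lemma weight_cutoff T (z : R * space) : (time_poly T).[z.1] * weight (space_poly T) z.2 =
  z.2 ord0 ord_max * cutoff T z ^+ m.+2.
Proof.
by rewrite weight_space_poly bumpE /cutoff exprMn mulrCA.
Qed.

Lemma time_poly_bnd T : 0 < T -> [/\ (time_poly T).[T ^+ 2] = 0,
  (time_poly T)^`().[T ^+ 2] = 0, (time_poly T).[0] = 1 & (time_poly T)^`().[0] = 0].
Proof.
move=> T0; have E : 1 - T ^- 4 * (T ^+ 2) ^+ 2 = 0.
  by rewrite -exprM mulVf ?subrr// expf_neq0// gt_eqF.
rewrite /time_poly !bumpE !deriv_bump E; split.
- by rewrite expr0n.
- by rewrite expr0n mulr0.
- by rewrite expr0n mulr0 subr0 expr1n.
- by rewrite mulr0 oppr0 mul0r.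
Qed.

Lemma space_poly_bnd T i : 0 < T -> [/\ (space_poly T i).[T] = 0,
  (space_poly T i)^`().[T] = 0,
  (space_poly T i).[if i == ord_max then 0 else - T] = 0 &
  i != ord_max -> (space_poly T i)^`().[- T] = 0].
Proof.
move=> T0; have E : 1 - T ^- 2 * T ^+ 2 = 0.
  by rewrite mulVf ?subrr// expf_neq0// gt_eqF.
have b0 : (bump_poly m (T ^- 2)).[T] = 0 by rewrite bumpE E expr0n.
have b1 : (bump_poly m (T ^- 2))^`().[T] = 0 by rewrite deriv_bump E expr0n mulr0.
rewrite /space_poly; case: ifPn => iN; split => //.
- by rewrite hornerM b0 mulr0.
- by rewrite deriv_Xbump b0 b1 mulr0 addr0.
- by rewrite hornerM hornerX mul0r.
- by rewrite bumpE sqrrN E expr0n.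
- by rewrite deriv_bump sqrrN E expr0n mulr0.
Qed.

Let factor_ge0 T i s : 0 < T -> side T i s -> 0 <= factor i s.
Proof.
move=> T0; rewrite /side /factor/= in_itv/=; case: ifP => // _ /andP[s0 _].
exact: ltW.
Qed.

Let space_poly2_le T i s : 0 < T -> side T i s ->
  `| (space_poly T i)^`()^`().[s] | <=
  bump_const m * T ^- 2 * (factor i s * space_cut T s ^+ m).
Proof.
move=> T0 si; have /andP[c0 c1] := space_cut_itv T0 si.
have f0 := factor_ge0 T0 si.
have T20 : 0 <= T ^- 2 by rewrite invr_ge0 exprn_ge0// ltW.
have a01 : 0 <= T ^- 2 * s ^+ 2 <= 1.
  rewrite mulr_ge0 ?sqr_ge0//=; move: c0; rewrite /space_cut; lra.
have k6 : 0 <= (6 * m.+2%:R : R) <= 6 * m.+2%:R by rewrite lexx mulr_ge0.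
have k2 : 0 <= (2 * m.+2%:R : R) <= 6 * m.+2%:R.
  by rewrite mulr_ge0//= ler_wpM2r// ler_nat.
move: f0; rewrite /space_poly /factor; case: ifP => _ f0.
  rewrite deriv2_Xbump normrM (ger0_norm f0) [leRHS]mulrCA ler_wpM2l//.
  rewrite normrM ger0_norm ?exprn_ge0 ?(ltW c0)// mulrC ler_wpM2r ?exprn_ge0 ?(ltW c0)//.
  exact: bump_bracket.
rewrite deriv2_bump mul1r normrM ger0_norm ?exprn_ge0 ?(ltW c0)//.
rewrite mulrC ler_wpM2r ?exprn_ge0 ?(ltW c0)//.
exact: bump_bracket.
Qed.

(** The second derivative is of order [T^-4] and the first of order [T^-4 t]. Both are controlled by
    [T^-2], since [T >= 1] and [t < T^2]; hence the factor 2. *)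
Let time_poly2_le T t : 1 <= T -> t \in `]0, T ^+ 2[ ->
  `| (time_poly T)^`()^`().[t] - (time_poly T)^`().[t] | <=
  2 * bump_const m * T ^- 2 * time_cut T t ^+ m.
Proof.
move=> T1 tI; have T0 : 0 < T by exact: lt_le_trans T1.
have /andP[c0 c1] := time_cut_itv T0 tI.
have T40 : 0 <= T ^- 4 by rewrite invr_ge0 exprn_ge0// ltW.
have T42 : T ^- 4 <= T ^- 2 by rewrite lef_pV2 ?posrE ?exprn_gt0// ler_weXn2l.
have /andP[t0 tT] : 0 <= t <= T ^+ 2.
  by move: tI; rewrite in_itv/= => /andP[/ltW -> /ltW ->].
have a01 : 0 <= T ^- 4 * t ^+ 2 <= 1.
  rewrite mulr_ge0 ?sqr_ge0//=; move: c0; rewrite /time_cut; lra.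
have B0 : 0 <= (bump_const m : R) by rewrite /bump_const mulr_ge0// sqr_ge0.
have k2 : 0 <= (2 * m.+2%:R : R) <= 6 * m.+2%:R.
  by rewrite mulr_ge0//= ler_wpM2r// ler_nat.
have m1 : 1 <= m.+2%:R :> R by rewrite ler1n.
have Tt : T ^- 4 * t <= T ^- 2.
  apply: le_trans (ler_wpM2l T40 tT) _.
  by rewrite -[4%N]/(2 + 2)%N exprD invfM mulfVK// expf_neq0// gt_eqF.
apply: le_trans (ler_normB _ _) _.
have -> : 2 * bump_const m * T ^- 2 * time_cut T t ^+ m =
  time_cut T t ^+ m * (bump_const m * T ^- 2) +
  time_cut T t ^+ m * (bump_const m * T ^- 2) by ring.
rewrite deriv2_bump deriv_bump !normrM normrN -/(time_cut T t).
rewrite (ger0_norm (exprn_ge0 _ (ltW c0))); apply: lerD.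
  rewrite ler_wpM2l ?exprn_ge0 ?(ltW c0)//.
  apply: le_trans (bump_bracket k2 T40 a01) _.
  by rewrite ler_wpM2l.
rewrite (ger0_norm (exprn_ge0 _ (ltW c0))) mulrC; apply: ler_pM => //.
- by rewrite exprn_ge0// ltW.
- by apply: ler_wiXn2l => //; rewrite ltW.
rewrite -mulrA normrM !ger0_norm ?mulr_ge0//.
apply: ler_pM => //; rewrite ?mulr_ge0//.
rewrite /bump_const expr2 mulrA; apply: le_trans (_ : 6 * m.+2%:R <= _).
  by rewrite ler_wpM2r// ler_nat.
by rewrite ler_peMr// mulr_ge0.
Qed.

(** The count [n+3] is 2 for the time derivatives plus 1 for each of the [n+1] space directions. The
    cut-offs lie between 0 and 1, so all their higher powers may be lowered to [m]. *)
Lemma adj_le T (z : R * space) : 1 <= T -> cylinder T z ->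
  `| adj (time_poly T) (space_poly T) z | <=
  z.2 ord0 ord_max * (cutoff T z ^+ m * (n.+3%:R * bump_const m * T ^- 2)).
Proof.
move=> T1 [/= zt zx]; have T0 : 0 < T by exact: lt_le_trans T1.
have /andP[c0 c1] := time_cut_itv T0 zt.
have B0 : 0 <= (bump_const m : R) by rewrite /bump_const mulr_ge0// sqr_ge0.
have T20 : 0 <= T ^- 2 by rewrite invr_ge0 exprn_ge0// ltW.
have s01 i : 0 <= space_cut T (z.2 ord0 i) <= 1.
  by have /andP[/ltW -> ->] := space_cut_itv T0 (zx i).
have f0 i := factor_ge0 T0 (zx i).
have pow_le (a : R) : 0 <= a <= 1 -> 0 <= a ^+ m.+2 <= a ^+ m.
  move=> /andP[a0 a1]; rewrite exprn_ge0//=.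
  by apply: ler_wiXn2l => //; rewrite ltnW.
have prodE : \prod_i (factor i (z.2 ord0 i) * space_cut T (z.2 ord0 i) ^+ m) =
    z.2 ord0 ord_max * (\prod_i space_cut T (z.2 ord0 i)) ^+ m.
  by rewrite big_split/= prod_factor prodrXl.
have W0 : 0 <= weight (space_poly T) z.2 <=
    z.2 ord0 ord_max * (\prod_i space_cut T (z.2 ord0 i)) ^+ m.
  rewrite -prodE /weight; apply/andP; split.
    apply: prodr_ge0 => i _; rewrite space_polyE mulr_ge0//.
    by have /andP[] := pow_le _ (s01 i).
  apply: ler_prod => i _; rewrite space_polyE.
  have /andP[h1 h2] := pow_le _ (s01 i).
  by rewrite mulr_ge0//= ler_wpM2l.
have Wi0 i : `|weight_but (space_poly T) i z.2 *
      (space_poly T i)^`()^`().[z.2 ord0 i]| <= bump_const m * T ^- 2 *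
    (z.2 ord0 ord_max * (\prod_i space_cut T (z.2 ord0 i)) ^+ m).
  rewrite -prodE (bigD1 i)//= [leRHS]mulrA mulrC normrM.
  have /andP[wb0 wbP] : 0 <= weight_but (space_poly T) i z.2 <=
      \prod_(j | j != i) (factor j (z.2 ord0 j) * space_cut T (z.2 ord0 j) ^+ m).
    rewrite /weight_but; apply/andP; split.
      apply: prodr_ge0 => j _; rewrite space_polyE mulr_ge0//.
      by have /andP[] := pow_le _ (s01 j).
    apply: ler_prod => j _; rewrite space_polyE.
    have /andP[h1 h2] := pow_le _ (s01 j).
    by rewrite mulr_ge0//= ler_wpM2l.
  rewrite [X in _ * X]ger0_norm//; apply: ler_pM => //.
  exact: (space_poly2_le T0 (zx i)).
have /andP[q0 q1] : 0 <= (time_poly T).[z.1] <= time_cut T z.1 ^+ m.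
  by rewrite bumpE; apply: pow_le; rewrite ltW.
have /andP[W0' W1] := W0.
rewrite /cutoff exprMn; move: Wi0 W1; set P := \prod_i _; set S := _ * P ^+ m.
move=> Wi0 W1.
have S0 : 0 <= S by exact: le_trans W0' W1.
have -> : z.2 ord0 ord_max * (time_cut T z.1 ^+ m * P ^+ m *
      (n.+3%:R * bump_const m * T ^- 2)) =
    S * (2 * bump_const m * T ^- 2 * time_cut T z.1 ^+ m) +
    \sum_(i < n.+1) (time_cut T z.1 ^+ m * (bump_const m * T ^- 2 * S)).
  rewrite sumr_const card_ord -mulr_natl /S -[n.+3]addn2 natrD; ring.
apply: le_trans (ler_normB _ _) _; apply: lerD.
  rewrite normrM (ger0_norm W0'); apply: ler_pM => //.
  exact: time_poly2_le.
apply: le_trans (ler_norm_sum _ _ _) _; apply: ler_sum => i _.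
by rewrite -mulrA normrM (ger0_norm q0); apply: ler_pM => //; exact: Wi0.
Qed.
End test_function.

(** The condition on [m] gives [(cutoff^m)^p <= cutoff^(m+2)], which recovers the power lost to two
    derivatives. The second bound is for decay in [T], the third for comparison with the nonlinear
    term. *)
Lemma adj_young (R : realType) (n m : nat) (p M T u : R) (z : R * 'rV[R]_n.+1) :
  1 < p -> p <= 1 + 2 / (n.+1%:R + 1) -> m.+2%:R <= m%:R * p ->
  0 < M -> 1 <= T -> cylinder T z ->
  let C : R := n.+3%:R * bump_const m in
  let b := z.2 ord0 ord_max * (`|u| * cutoff T z ^+ m * (C * T ^- 2)) in
  [/\ u * adj (time_poly m T) (space_poly m T) z <= b,
      b <= z.2 ord0 ord_max * `|u| * C * T ^- 2 &
      b <= C * M `^ (- (p - 1)) * (z.2 ord0 ord_max * cutoff T z ^+ m.+2 * `|u| `^ p)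
           + C * M * T ^- n.+4 * T].
Proof.
move=> p1 pn mp M0 T1 zT C b.
have x0 : 0 < z.2 ord0 ord_max by have [_] := cylinder_interior zT.
have /andP[c0 c1] := cutoff_itv zT.
have C0 : 0 <= C by rewrite /C mulr_ge0// /bump_const mulr_ge0// sqr_ge0.
have T0 : 0 < T by exact: lt_le_trans T1.
have T20 : 0 <= T ^- 2 by rewrite invr_ge0 exprn_ge0// ltW.
have adjC : `|adj (time_poly m T) (space_poly m T) z| <=
    z.2 ord0 ord_max * (cutoff T z ^+ m * (C * T ^- 2)) by exact: adj_le.
clearbody C; split.
- apply: le_trans (ler_norm _) _; rewrite normrM /b -[`|u| * _ * _]mulrA mulrCA.
  by rewrite ler_wpM2l.
- rewrite /b !mulrA ler_wpM2r// ler_wpM2r// -!mulrA.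
  rewrite ler_wpM2l ?(ltW x0)// ler_piMr//.
  by rewrite exprn_ile1// ltW.
- have X0 : 0 <= `|u| * cutoff T z ^+ m by rewrite mulr_ge0// exprn_ge0// ltW.
  have Y := young_split p1 pn C0 M0 T1 X0.
  apply: le_trans (ler_wpM2l (ltW x0) Y) _.
  rewrite mulrDr; apply: lerD.
    rewrite mulrCA ler_wpM2l ?mulr_ge0 ?powR_ge0//.
    rewrite -mulrA ler_wpM2l ?(ltW x0)//.
    rewrite powRM ?exprn_ge0 ?(ltW c0)// mulrC ler_wpM2r ?powR_ge0//.
    rewrite -!powR_mulrn ?(ltW c0)// -powRrM.
    by apply: ger_powR => //; rewrite c0 c1.
  rewrite mulrC ler_wpM2l ?mulr_ge0 ?(ltW M0) ?invr_ge0 ?exprn_ge0 ?(ltW T0)//.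
  (* The last factor [T] of the error bounds [x_N]. *)
  have [_ /(_ ord_max)] := zT; rewrite /side/= in_itv/= => /andP[_ /ltW //].
Qed.

(** * Exhaustion of spacetime by the cylinders *)

Section limits.
Context {R : realType} {n : nat}.
Notation space := 'rV[R]_n.+1.
Implicit Types (m k : nat).

Lemma cvg_natV j : (k.+1%:R ^- j.+1 : R) @[k --> \oo] --> (0 : R).
Proof.
under eq_fun do rewrite -exprVn.
elim: j => [|j IH]; first exact: cvg_harmonic.
under eq_fun do rewrite exprS.
have := cvgM (@cvg_harmonic R) IH; rewrite mul0r; apply.
Qed.

Lemma near_cylinder (z : R * space) : spacetime_interior z ->
  \forall k \near \oo, cylinder k.+1%:R z.
Proof.
move=> [z1 z2].
(* The sum bounds every coordinate, and [t < k+1] implies [t < (k+1)^2]. *)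
have : \forall k \near \oo, z.1 + \sum_i `|z.2 ord0 i| < k%:R by exact: nbhs_infty_gtr.
apply: filterS => k zk; have kk : k%:R <= k.+1%:R :> R by rewrite ler_nat.
have s0 : 0 <= \sum_i `|z.2 ord0 i| by apply: sumr_ge0.
have T1 : 1 <= k.+1%:R :> R by rewrite ler1n.
rewrite /= in z1.
split => /=.
  rewrite in_itv/= z1/=; apply: (@lt_le_trans _ _ k.+1%:R); first lra.
  by rewrite expr2 ler_peMr.
move=> i; have : `|z.2 ord0 i| < k.+1%:R.
  have : `|z.2 ord0 i| <= \sum_i `|z.2 ord0 i|.
    by rewrite (bigD1 i)//= lerDl sumr_ge0.
  lra.
rewrite ltr_norml => /andP[zi1 zi2]; rewrite /side/= in_itv/= zi2 andbT.
by case: ifPn => // /eqP ->.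
Qed.

Let cvg_one_sub j (a : R) : 1 - k.+1%:R ^- j.+1 * a @[k --> \oo] --> (1 : R).
Proof.
have := cvgB (cvg_cst (1 : R)) (cvgM (cvg_natV j) (cvg_cst a)).
by rewrite mul0r subr0; apply.
Qed.

Lemma cvg_space_cut (x : space) :
  \prod_i space_cut k.+1%:R (x ord0 i) @[k --> \oo] --> (1 : R).
Proof.
have mulc : continuous (fun x : R * R => x.1 * x.2) by exact: mul_continuous.
have := @cvg_big R _ *%R 1 predT mulc nat \oo (index_enum 'I_n.+1)
  (fun i k => space_cut k.+1%:R (x ord0 i)) (fun=> 1) _.
by rewrite big1//; apply => i _; exact: cvg_one_sub.
Qed.

Lemma cvg_cutoff (z : R * space) : cutoff k.+1%:R z @[k --> \oo] --> (1 : R).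
Proof.
have := cvgM (@cvg_one_sub 3 (z.1 ^+ 2)) (@cvg_space_cut z.2).
by rewrite mulr1; apply.
Qed.

End limits.

Lemma limn_einf_le_cst (R : realType) (v : (\bar R)^nat) (K : \bar R) :
  (forall k, (v k <= K)%E) -> (limn_einf v <= K)%E.
Proof.
move=> vK; rewrite limn_einf_lim; apply: lime_le; first exact: is_cvg_einfs.
apply: nearW => k; apply: le_trans (vK k); apply: ereal_inf_lbound.
by exists k => /=.
Qed.

(** * Estimates uniform in the scale, and the contradiction *)

Section blowup.
Context {R : realType} {n : nat} {p : R} {u0 u1 : 'rV[R]_n.+1 -> R}.
Context {U : R * 'rV[R]_n.+1 -> R} {G H : option 'I_n.+1 -> R * 'rV[R]_n.+1 -> R}.
Hypothesis sol : smooth_solution p u0 u1 U G H.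
Hypotheses (p_gt1 : 1 < p) (p_le : p <= 1 + 2 / (n.+1%:R + 1)).
Notation space := 'rV[R]_n.+1.
Notation spacetime := (measurableTypeR R * space)%type.
Local Notation leb := (@lebesgue_measure R).
Local Notation lebn := (@lebesgue_rV R n.+1).
Local Notation mu := (leb \x lebn)%E.
Hypothesis u0_int : lebn.-integrable half_space
     (fun x => (x ord0 ord_max * u0 x)%:E).
Hypothesis u1_int : lebn.-integrable half_space
     (fun x => (x ord0 ord_max * u1 x)%:E).
Variable m : nat.
Hypothesis mp : m.+2%:R <= m%:R * p.

Let T k : R := k.+1%:R.
Let T_ge1 k : 1 <= T k. Proof. by rewrite ler1n. Qed.
Let T_gt0 k : 0 < T k. Proof. by []. Qed.
Let D : set spacetime := spacetime_interior.
Let xn (z : R * space) : R := z.2 ord0 ord_max.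

Let I k : R := (\int[mu]_(z in cylinder (T k))
  (xn z * cutoff (T k) z ^+ m.+2 * `|U z| `^ p))%R.
Let J k : R := (\int[lebn]_(x in box (T k))
  (weight (space_poly m (T k)) x * (u0 x + u1 x)))%R.
Let B k : R := (\int[mu]_(z in cylinder (T k))
  (U z * adj (time_poly m (T k)) (space_poly m (T k)) z))%R.
Let C : R := n.+3%:R * bump_const m.

Let C_ge0 : 0 <= C.
Proof. by rewrite /C mulr_ge0// /bump_const mulr_ge0// sqr_ge0. Qed.

Let measurable_D : measurable D.
Proof. exact: open_measurable_prod_rV open_spacetime_interior. Qed.

Let measurable_half_space : measurable (half_space : set space).
Proof.
rewrite (_ : half_space = setT `&` (fun x : space => x ord0 ord_max) @^-1` `]0, +oo[).
  by apply: measurable_rV_coord => //; exact: measurable_itv.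
by apply/seteqP; split => x; rewrite /half_space/= in_itv/= andbT//; case.
Qed.

Let cylinder_D k : cylinder (T k) `<=` D.
Proof. by move=> z; exact: cylinder_interior. Qed.

Let weak k : mu.-integrable (cylinder (T k))
    (fun z => (xn z * cutoff (T k) z ^+ m.+2 * `|U z| `^ p)%:E) /\
  I k + J k = B k.
Proof.
have [q1 q2 q3 q4] := time_poly_bnd m (T_gt0 k).
have h1 (i : 'I_n.+1) : (space_poly m (T k) i).[T k] = 0 /\ (space_poly m (T k) i)^`().[T k] = 0.
  by have [] := @space_poly_bnd _ n m (T k) i (T_gt0 k).
have h2 (i : 'I_n.+1) : (space_poly m (T k) i).[if i == ord_max then 0 else - T k] = 0.
  by have [] := @space_poly_bnd _ n m (T k) i (T_gt0 k).
have h3 (i : 'I_n.+1) : i != ord_max -> (space_poly m (T k) i)^`().[- T k] = 0.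
  by have [_ _ _] := @space_poly_bnd _ n m (T k) i (T_gt0 k).
have [iw eqw] := weak_formulation sol (T_gt0 k) q1 q2 q3 q4 h1 h2 h3.
under eq_fun do rewrite /xn -weight_cutoff.
split => //; rewrite -[RHS]eqw /I /xn.
by under eq_Rintegral do rewrite -weight_cutoff.
Qed.

Let integrable_Uadj k : mu.-integrable (cylinder (T k))
  (EFin \o (fun z => U z * adj (time_poly m (T k)) (space_poly m (T k)) z)).
Proof.
apply: continuous_integrable_cylinder => // z; apply: cvgM.
  exact: smooth_cont sol _.
exact: continuous_adj.
Qed.

(** The powers of [T k] cancel against the measure of the cylinder, so the bound does not depend on
    [k]. *)
Let int_const k (M : R) : 0 <= M ->
  (\int[mu]_(z in cylinder (T k)) (C * M * T k ^- n.+4 * T k))%R <=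
  C * M * 2 ^+ n.+1.
Proof.
move=> M0; have mT := @measurable_box_cylinder R n (T k).
rewrite Rintegral_cst//.
have := @measure_box_cylinder R n (T k) (T_gt0 k).
have m0 : (0 <= mu (cylinder (T k)))%E by exact: measure_ge0.
move=> mle; have : fine (mu (cylinder (T k))) <= 2 ^+ n.+1 * T k ^+ n.+3.
  rewrite -lee_fin fineK// ge0_fin_numE//; apply: le_lt_trans mle _.
  by rewrite ltry.
move=> h; have cM : 0 <= C * M * T k ^- n.+4 * T k.
  by rewrite !mulr_ge0// invr_ge0 exprn_ge0.
apply: le_trans (ler_wpM2l cM h) _; rewrite le_eqVlt; apply/orP; left; apply/eqP.
have T0 : T k != 0 by rewrite gt_eqF.
have E : T k ^- n.+4 * (T k * T k ^+ n.+3) = 1.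
  by rewrite -exprS mulVf// expf_neq0.
by rewrite -[RHS]mulr1 -E; ring.
Qed.

Let integrable_const k (c : R) :
  mu.-integrable (cylinder (T k)) (EFin \o (fun=> c)).
Proof. by apply: continuous_integrable_cylinder => // z; exact: cvg_cst. Qed.

(** The third bound of [adj_young], integrated. For large [M] the coefficient of [I k] on the right
    is small enough to move that term to the left. *)
Let absorb k (M : R) : 0 < M ->
  I k + J k <= C * M `^ (- (p - 1)) * I k + C * M * 2 ^+ n.+1.
Proof.
move=> M0; have [iw ->] := weak k.
have mT := @measurable_box_cylinder R n (T k).
apply: le_trans (lerD (lexx _) (int_const k (ltW M0))).
have iAw : mu.-integrable (cylinder (T k)) (EFin \o (fun z =>
    C * M `^ (- (p - 1)) * (xn z * cutoff (T k) z ^+ m.+2 * `|U z| `^ p))).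
  by apply: eq_integrable (integrableZl mT (C * M `^ (- (p - 1))) iw).
rewrite /I -RintegralZl// -RintegralD//.
apply: le_Rintegral => //.
  by apply: eq_integrable (integrableD mT iAw
    (integrable_const k (C * M * T k ^- n.+4 * T k))).
move=> z zT; have [a b c] := adj_young (U z) p_gt1 p_le mp M0 (T_ge1 k) zT.
exact: le_trans a c.
Qed.


Let Jlim : R := (\int[lebn]_(x in half_space) (x ord0 ord_max * (u0 x + u1 x)))%R.

Let data_int : lebn.-integrable half_space
  (fun x => (x ord0 ord_max * (u0 x + u1 x))%:E).
Proof.
apply: eq_integrable (integrableD measurable_half_space u0_int u1_int) => // x _.
by rewrite /= -EFinD mulrDr.
Qed.

Let prod_cut k (x : space) := \prod_i space_cut (T k) (x ord0 i).

Let measurable_prod_cut k : measurable_fun (half_space : set space) (prod_cut k).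
Proof.
apply: measurable_prod => i _; apply: measurable_funB => //.
apply: measurable_funM => //; apply: measurable_funX.
by apply: measurable_funTS; exact: measurable_rV_coord.
Qed.

(** Dominated convergence with majorant [x_N |u0 + u1|]: the cut-offs lie between 0 and 1 and tend
    to 1, while the boxes exhaust the half-space. *)
Let cvg_J : J k @[k --> \oo] --> Jlim.
Proof.
pose f := fun k (x : space) =>
  ((weight (space_poly m (T k)) x * (u0 x + u1 x))%:E).
have -> : J = fine \o (fun k => \int[lebn]_(x in half_space) (f k \_ (box (T k))) x)%E.
  apply/funext => k; rewrite /J /Rintegral /=; congr fine.
  rewrite -integral_mkcondr setIidr// => x; exact: box_half_space.
apply: fine_cvg; rewrite [X in _ --> X]fineK; last first.
  exact: integrable_fin_num.
pose g (x : space) := ((x ord0 ord_max * (u0 x + u1 x))%:E).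
apply: (@dominated_cvg _ _ _ lebn half_space measurable_half_space _ _ (abse \o g)).
- move=> k; apply/measurable_restrict => //; first exact: measurable_box.
  rewrite /f; under eq_fun do rewrite weight_space_poly mulrAC.
  apply/measurable_EFinP; apply: measurable_funM.
    apply: (@measurable_funS _ _ _ _ half_space) => //.
    by apply/measurable_EFinP; exact: measurable_int data_int.
  apply: measurable_funX.
  apply: (measurable_funS measurable_half_space _ (measurable_prod_cut k)).
  exact: subIsetl.
- move=> x x0.
  have fE : \forall k \near \oo, (x ord0 ord_max * (u0 x + u1 x) *
      (prod_cut k x) ^+ m.+2)%:E = (f k \_ (box (T k))) x.
    (* The time 1 is arbitrary; only the spatial part of the cylinder is kept. *)
    have : spacetime_interior (1 : R, x) by split => //; exact: ltr01.
    move=> /near_cylinder; apply: filterS => k [_ xk].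
    by rewrite patchE mem_set// /f weight_space_poly mulrAC.
  apply: cvg_trans; first by apply: near_eq_cvg; exact: fE.
  apply: cvg_EFin; first by apply: nearW.
  have := cvgM (cvg_cst (x ord0 ord_max * (u0 x + u1 x)))
    (continuous_cvg _ (@exprn_continuous R m.+2 1) (@cvg_space_cut R n x)).
  by rewrite expr1n mulr1; apply.
- by move=> x _.
- exact: integrable_abse.
- move=> k x x0; rewrite patchE; case: ifPn => [|_]; last by rewrite /= lee_fin normr0.
  rewrite inE => xB; rewrite /f weight_space_poly mulrAC /g /= lee_fin normrM.
  rewrite ler_piMr// normrX exprn_ile1//.
  have : 0 < prod_cut k x <= 1.
    by apply: prod_itv01 => i _; apply: space_cut_itv (xB i).
  by move=> /andP[c0 c1]; rewrite ger0_norm// ltW.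
Qed.

Let w (z : R * space) : R := xn z * `|U z| `^ p.

Let measurable_xn (S : set spacetime) : measurable_fun S (xn : _ -> measurableTypeR R).
Proof.
apply: measurable_funTS; apply: continuous_measurable_prod_rV => z.
apply: (@continuous_comp _ _ _ snd (fun x : space => x ord0 ord_max)).
  exact: cvg_snd.
exact: coord_continuous.
Qed.

Let measurable_U (S : set spacetime) : measurable_fun S (fun z => `|U z|).
Proof.
apply: measurableT_comp => //; apply: measurable_funTS.
by apply: continuous_measurable_prod_rV => z; exact: smooth_cont sol _.
Qed.

Let measurable_w (S : set spacetime) : measurable_fun S w.
Proof.
apply: measurable_funM; first exact: measurable_xn.
by apply: (measurableT_comp (measurable_powR p)); exact: measurable_U.
Qed.

Let xn_ge0 z : D z -> 0 <= xn z.
Proof. by case=> _ /ltW. Qed.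

Let w_ge0 z : D z -> 0 <= w z.
Proof. by move=> zD; rewrite mulr_ge0 ?xn_ge0// powR_ge0. Qed.

Hypothesis data_gt0 : (0 < \int[lebn]_(x in half_space)
  (x ord0 ord_max * (u0 x + u1 x))%:E)%E.

Let Jlim_gt0 : 0 < Jlim.
Proof.
rewrite fine_gt0// data_gt0/= ltey_eq.
by rewrite (integrable_fin_num measurable_half_space data_int).
Qed.

Let density_ge0 k z : cylinder (T k) z ->
  0 <= xn z * cutoff (T k) z ^+ m.+2 * `|U z| `^ p.
Proof.
move=> zT; have /andP[c0 _] := cutoff_itv zT.
apply: mulr_ge0; last exact: powR_ge0.
apply: mulr_ge0; last exact: exprn_ge0 (ltW c0).
by apply: xn_ge0; exact: (cylinder_D zT).
Qed.

Let I_ge0 k : 0 <= I k.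
Proof. by apply: Rintegral_ge0 => z; exact: density_ge0. Qed.

Let I_bounded : exists K : R, \forall k \near \oo, I k <= K.
Proof.
have p10 : 0 < p - 1 by rewrite subr_gt0.
have C1 : 0 < 2 * C + 1 by rewrite ltr_wpDl// mulr_ge0.
(* Chosen so that the coefficient of [I k] is [C / (2 C + 1)], at most one half. *)
pose M := (2 * C + 1) `^ (p - 1)^-1.
have M0 : 0 < M by exact: powR_gt0.
have CM : C * M `^ (- (p - 1)) <= 1 / 2.
  rewrite /M -powRrM mulrN mulVf ?gt_eqF// powRN powRr1 ?(ltW C1)//.
  by rewrite ler_pdivrMr//; lra.
exists (2 * (C * M * 2 ^+ n.+1)).
have : \forall k \near \oo, 0 < J k by exact: (cvgr_gt Jlim cvg_J).
apply: filterS => k Jk; have := absorb k M0.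
have := ler_wpM2r (I_ge0 k) CM; lra.
Qed.

(** Fatou's lemma along the cylinders: the integrands of [I k] tend to [w], and the integrals are
    eventually bounded. *)
Let integrable_w : mu.-integrable D (EFin \o w).
Proof.
have [K [N _ IK]] := I_bounded.
apply/integrableP; split; first by apply/measurable_EFinP; exact: measurable_w.
(* The shift by [N] makes the bound on [I] valid at every index. *)
pose f := fun k => (fun z =>
  (xn z * cutoff (T (k + N)) z ^+ m.+2 * `|U z| `^ p)%:E) \_ (cylinder (T (k + N))).
have fw z : D z -> limn_einf (f ^~ z) = (w z)%:E.
  move=> zD; apply: (cvg_limn_einf_sup _).1.
  have /near_cylinder [N1 _ zN1] := zD.
  have fE : \forall k \near \oo, (w z * cutoff (T (k + N)) z ^+ m.+2)%:E = f k z.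
    exists N1 => // k /= Nk.
    have zT : cylinder (T (k + N)) z.
      by apply: zN1; exact: leq_trans Nk (leq_addr _ _).
    by rewrite /f patchE (mem_set zT) /w mulrAC.
  apply: cvg_trans; first by apply: near_eq_cvg; exact: fE.
  apply: cvg_EFin; first by apply: nearW.
  have cutN : cutoff (T (k + N)) z @[k --> \oo] --> (1 : R).
    have := @cvg_cutoff R n z.
    by rewrite -(cvg_shiftn N (fun k => cutoff (T k) z)); apply.
  have := cvgM (cvg_cst (w z)) (continuous_cvg _ (@exprn_continuous R m.+2 1) cutN).
  by rewrite expr1n mulr1; apply.
have -> : (\int[mu]_(z in D) `|(EFin \o w) z| = \int[mu]_(z in D) limn_einf (f ^~ z))%E.
  apply: eq_integral => z; rewrite inE => zD; rewrite fw//=.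
  by rewrite ger0_norm// w_ge0.
have mf k : measurable_fun D (f k).
  have [/integrableP[+ _] _] := weak (k + N).
  have mT := @measurable_box_cylinder R n (T (k + N)).
  move=> mw; apply/(measurable_restrict _ mT measurable_D).
  by rewrite setIidr//; exact: cylinder_D.
have f0 k z : D z -> (0 <= f k z)%E.
  move=> zD; apply: erestrict_ge0 => y yT.
  by rewrite lee_fin; exact: density_ge0.
apply: le_lt_trans (fatou mu measurable_D mf f0) _.
apply: (@le_lt_trans _ _ K%:E); last by rewrite ltry.
apply: limn_einf_le_cst => k.
rewrite -integral_mkcondr (setIidr (@cylinder_D _)).
have [iw _] := weak (k + N).
rewrite -[leLHS]fineK; last by apply: integrable_fin_num => //; exact: measurable_box_cylinder.
by rewrite lee_fin; apply: IK => /=; rewrite leq_addl.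
Qed.


(* Bounded by an integrable function for fixed [M], this tends to 0 as [k] grows,
   and it dominates [U * adj] up to the error [C * M]. *)
Let g (M : R) k (z : R * space) : R :=
  Num.min (xn z * `|U z| * C * T k ^- 2) (C * M `^ (- (p - 1)) * w z).

Let g_ge0 M k z : D z -> 0 <= g M k z.
Proof.
move=> zD; have x0 := xn_ge0 zD; have w0 := w_ge0 zD.
rewrite le_min; apply/andP; split; last first.
  by apply: mulr_ge0 => //; apply: mulr_ge0 => //; exact: powR_ge0.
apply: mulr_ge0; last by rewrite invr_ge0 exprn_ge0.
by apply: mulr_ge0 => //; exact: mulr_ge0.
Qed.

Let measurable_g M k : measurable_fun D (g M k).
Proof.
apply: measurable_minr; apply: measurable_funM => //.
apply: measurable_funM => //; apply: measurable_funM.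
  exact: measurable_xn.
exact: measurable_U.
Qed.

Let integrable_Aw M : mu.-integrable D (EFin \o (fun z => C * M `^ (- (p - 1)) * w z)).
Proof.
by apply: eq_integrable (integrableZl measurable_D (C * M `^ (- (p - 1))) integrable_w).
Qed.

Let integrable_g M k : mu.-integrable D (EFin \o g M k).
Proof.
apply: le_integrable (integrable_Aw M) => //.
  by apply/measurable_EFinP; exact: measurable_g.
move=> z zD; have g0 := g_ge0 M k zD.
rewrite /= lee_fin (ger0_norm g0) (le_trans _ (ler_norm _))//.
by rewrite /g ge_min lexx orbT.
Qed.

(** Since [I k >= 0], the weak identity gives [J k <= B k], and the integrand of [B k] is at most
    [g M k] plus the constant error. *)
Let J_le M k : 0 < M ->
  J k <= (\int[mu]_(z in D) g M k z)%R + C * M * 2 ^+ n.+1.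
Proof.
move=> M0; have mT := @measurable_box_cylinder R n (T k).
have ig : mu.-integrable (cylinder (T k)) (EFin \o g M k).
  exact: integrableS (integrable_g M k).
have JB : J k <= B k by have [_ <-] := weak k; rewrite lerDr I_ge0.
apply: le_trans JB _.
have gD : (\int[mu]_(z in cylinder (T k)) g M k z)%R <= (\int[mu]_(z in D) g M k z)%R.
  apply: fine_le; [exact: integrable_fin_num ig|
    exact: integrable_fin_num (integrable_g M k)|].
  apply: ge0_subset_integral => //; first by apply/measurable_EFinP; exact: measurable_g.
  by move=> z zD; rewrite lee_fin g_ge0.
apply: le_trans (lerD gD (int_const k (ltW M0))).
rewrite -RintegralD//.
apply: le_Rintegral => //.
  by apply: eq_integrable (integrableD mT ig
    (integrable_const k (C * M * T k ^- n.+4 * T k))).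
move=> z zT; have [a b c] := adj_young (U z) p_gt1 p_le mp M0 (T_ge1 k) zT.
have zD : D z by exact: (cylinder_D zT).
(* Each arm of the minimum comes from one bound of [adj_young]; in the second arm the cut-off is at
   most 1. *)
apply: le_trans a _; rewrite -lerBlDr le_min; apply/andP; split.
  rewrite lerBlDr; apply: le_trans b _; rewrite lerDl.
  by rewrite !mulr_ge0// ?invr_ge0 ?exprn_ge0// ltW.
rewrite lerBlDr; apply: le_trans c _; rewrite lerD2r.
apply: ler_wpM2l; first by rewrite mulr_ge0// powR_ge0.
have /andP[c0 c1] := cutoff_itv zT.
rewrite /w -/(xn z) mulrAC ler_piMr//; first exact: w_ge0.
by rewrite exprn_ile1// ltW.
Qed.

(** The first arm of the minimum tends to 0 pointwise like [T^-2]; the second is an integrable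
    majorant independent of [k]. *)
Let cvg_g M : (\int[mu]_(z in D) g M k z)%R @[k --> \oo] --> (0 : R).
Proof.
rewrite /Rintegral; apply: (@fine_cvg _ _ _ _ (fun k => \int[mu]_(z in D) (g M k z)%:E)%E).
have -> : 0%:E = (\int[mu]_(z in D) cst 0 z)%E by rewrite integral0.
apply: (dominated_cvg measurable_D _ _ _ (integrable_Aw M)) => //.
- by move=> k; apply/measurable_EFinP; exact: measurable_g.
- move=> z zD; apply: cvg_EFin; first exact: nearW.
  apply: (@squeeze_cvgr _ _ _ _ (cst 0) (fun k => xn z * `|U z| * C * T k ^- 2)).
  + by apply: nearW => k; rewrite g_ge0//= /g ge_min lexx.
  + exact: cvg_cst.
  + have := cvgM (cvg_cst (xn z * `|U z| * C)) (@cvg_natV R 1).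
    by rewrite mulr0; apply.
- move=> k z zD; have g0 := g_ge0 M k zD.
  by rewrite /= lee_fin (ger0_norm g0) /g ge_min lexx orbT.
Qed.

(** Letting [k] grow in [J_le] gives [Jlim <= q M] for every [M > 0], against [Jlim > 0]. *)
Lemma smooth_solution_blowup : False.
Proof.
pose q := C * 2 ^+ n.+1.
have q0 : 0 <= q by rewrite mulr_ge0// exprn_ge0.
(* Then [q M] is [Jlim] times [q / (2 (q + 1))], a factor below 1 even when [q = 0]. *)
pose M := Jlim / (2 * (q + 1)).
have M0 : 0 < M by rewrite divr_gt0// mulr_gt0// ltr_wpDl.
have : Jlim <= 0 + C * M * 2 ^+ n.+1.
  apply: (ler_cvg_to cvg_J (cvgD (@cvg_g M) (cvg_cst _))).
  by apply: nearW => k; exact: J_le.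
have -> : 0 + C * M * 2 ^+ n.+1 = Jlim * (q / (2 * (q + 1))).
  by rewrite /M /q; ring.
rewrite leNgt => /negP; apply.
rewrite gtr_pMr// ltr_pdivrMr ?mul1r ?mulr_gt0 ?ltr_wpDl//.
by clearbody q; lra.
Qed.

End blowup.

(* The dimension of the half-space is n.+1. *)
Theorem theorem1p1 (R : realType) (n : nat) (p : R) (u0 u1 : 'rV[R]_n.+1 -> R)
  (p_gt1 : 1 < p) (p_le : p <= 1 + 2 / (n.+1%:R + 1))
  (u0_int : (lebesgue_rV n.+1).-integrable half_space
     (fun x => (x ord0 ord_max * u0 x)%:E))
  (u1_int : (lebesgue_rV n.+1).-integrable half_space
     (fun x => (x ord0 ord_max * u1 x)%:E))
  (data_gt0 : (0 < \int[lebesgue_rV n.+1]_(x in half_space)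
     (x ord0 ord_max * (u0 x + u1 x))%:E)%E) :
  ~ exists u : R * 'rV[R]_n.+1 -> R, global_classical_solution p u0 u1 u.
Proof.
move=> [u /smooth_solution_exists [U [G [H sol]]]].
(* Any integer [m > 2 / (p - 1)] satisfies [m + 2 <= m p]. *)
pose m := (Num.truncn (2 / (p - 1))).+1.
have mp : m.+2%:R <= m%:R * p.
  have : 2 / (p - 1) < m%:R by exact: truncnS_gt.
  rewrite ltr_pdivrMr ?subr_gt0// mulrBr mulr1 -[m.+2]addn2 natrD; lra.
exact: (smooth_solution_blowup sol p_gt1 p_le u0_int u1_int mp data_gt0).
Qed.
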